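(* Let $N\ge 1$, let $Z_1=(X_1,Y_1),\dots,Z_{N+1}=(X_{N+1},Y_{N+1})$ be independent random variables with values in $\mathcal X\times\mathcal Y$, $Z_k\sim P^k$, let $P^{\mathrm{cal}}=\frac1N\sum_{k=1}^N P^k$ and assume $P^{N+1}\ll P^{\mathrm{cal}}$. Let $\lambda=\frac{\mathrm dP^{N+1}}{\mathrm dP^{\mathrm{cal}}}$, $\lambda_k=\lambda(Z_k)$ and $V_k=V(Z_k)$ for $k\in\{1,\dots,N+1\}$, and let $\alpha\in(0,1)$. Assume that almost surely there are no ties between the elements of $\{V_k\}_{k\in\{1,\dots,N+1\}}\cup\{\infty\}$. If $\lambda_k-\mathbb E\lambda_k$ is sub-Gaussian with parameter $\sigma_k\ge 0$ for each $k\in\{1,\dots,N\}$, then for any $\delta\in(0,1)$, with probability at least $1-\delta$ (over $\mathcal D_N=\{Z_k\}_{k=1}^N$), $$-\frac{\tau_{N,\delta}+3N^{-1}\mathbb E\lambda_{N+1}}{1+N^{-1}\mathbb E\lambda_{N+1}}<\alpha(\mathcal D_N)-\alpha<\tau_{N,\delta}+\sup_{v\in\mathbb R}\mathbb P(V_{N+1}=v),$$ where $$\tau_{N,\delta}=\frac1N\sqrt{8\log\left(\frac{6}{\delta}\right)\sum_{k=1}^N\left(4\sigma_k^2+(\mathbb E\lambda_k)^2\right)} .$$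
   Context: $V:\mathcal X\times\mathcal Y\to[0,\infty)$ is a fixed measurable (non-conformity score) function; $\lambda$ takes values in $[0,\infty)$. A real random variable $W$ is sub-Gaussian with parameter $\sigma\ge0$ if $\mathbb E[e^{tW}]\le e^{t^2\sigma^2/2}$ for all $t\in\mathbb R$. For a probability measure $\mu$ on $\mathbb R\cup\{\infty\}$ and $\beta\in[0,1]$, $Q_\beta(\mu)=\inf\{v:\mu((-\infty,v])\ge\beta\}$ is its $\beta$-quantile ($+\infty$ if no finite $v$ qualifies). $\delta_v$ is the Dirac mass at $v$. For $(x,y)\in\mathcal X\times\mathcal Y$ define $$p_k^{(x,y)}=\frac{\lambda_k}{\lambda(x,y)+\sum_{l=1}^N\lambda_l}\ (1\le k\le N),\qquad p_{N+1}^{(x,y)}=\frac{\lambda(x,y)}{\lambda(x,y)+\sum_{l=1}^N\lambda_l},$$ $$\mu^{(x,y)}=\sum_{k=1}^N p_k^{(x,y)}\delta_{V_k}+p_{N+1}^{(x,y)}\delta_\infty ,\qquad \mathcal C_{\alpha,\mu}(x)=\{y\in\mathcal Y: V(x,y)\le Q_{1-\alpha}(\mu^{(x,y)})\}.$$ The denominators are almost surely positive at $(x,y)=Z_{N+1}$. The conditional miscoverage rate is $\alpha(\mathcal D_N)=\mathbb P\left(Y_{N+1}\notin\mathcal C_{\alpha,\mu}(X_{N+1})\mid\mathcal D_N\right)$. *)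

(* Defs.v *)
From HB Require Import structures.
From mathcomp Require Import all_boot all_order all_algebra.
From mathcomp Require Import all_classical all_reals all_analysis.
From mathcomp Require Import measurable_realfun.

Set Implicit Arguments.
Unset Strict Implicit.
Unset Printing Implicit Defensive.

Import Order.TTheory GRing.Theory Num.Theory.
Import numFieldNormedType.Exports.

Local Open Scope classical_set_scope.
Local Open Scope ring_scope.

Definition calib {N : nat} (k : 'I_N) : 'I_N.+1 := widen_ord (leqnSn N) k.

Section probability_notions.
Context {d d'} {W : measurableType d} {T : measurableType d'} {R : realType}.
Variable P : probability W R.

Definition mutually_independent n (Z : 'I_n -> {RV P >-> T}) : Prop :=
  forall (J : {set 'I_n}) (B : 'I_n -> set T),
    (forall k, measurable (B k)) ->
    (P (\bigcap_(k in [set` J]) Z k @^-1` B k) =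
     \prod_(k in J) P (Z k @^-1` B k))%E.

Definition sub_gaussian (U : W -> R) (s : R) : Prop :=
  forall t : R,
    ('E_P[fun w => expR (t * U w)] <= (expR (t ^+ 2 * s ^+ 2 / 2))%:E)%E.

(* [f] is a version of the conditional probability of [E] given the
   sigma-algebra [G]; versions are unique up to a [P]-null set. *)
Definition is_cond_prob (G : set (set W)) (E : set W) (f : W -> R) : Prop :=
  [/\ forall B : set R, measurable B -> G (f @^-1` B),
      P.-integrable [set: W] (EFin \o f) &
      forall A, G A -> (\int[P]_(w in A) (f w)%:E = P (A `&` E))%E].

Section average_law.
Variables (N : nat) (Z : 'I_N.+1 -> {RV P >-> T}).

(* [msum] takes a [nat]-indexed family; only the indices [k < N] are used. *)
Definition Pcal : set T -> \bar R :=
  mscale (N%:R^-1)%:nng (msum (fun k => distribution P (Z (inord k))) N).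

HB.instance Definition _ := Measure.on Pcal.

Lemma PcalE (A : set T) :
  Pcal A = ((N%:R^-1)%:E * \sum_(k < N) distribution P (Z (calib k)) A)%E.
Proof.
rewrite /Pcal /mscale/= /msum/=; congr (_ * _)%E; apply: eq_bigr => k _.
by congr (distribution P (Z _) A); apply: val_inj; rewrite /= inordK// ltnS ltnW.
Qed.

Let Pcal_fin : fin_num_fun Pcal.
Proof.
move=> A mA; rewrite PcalE fin_numM// sum_fin_num.
by apply/allP => x /mapP[k _ ->]; exact: fin_num_measure.
Qed.

HB.instance Definition _ := Measure_isFinite.Build _ _ _ Pcal Pcal_fin.

End average_law.
End probability_notions.

Section weighted_conformal.
Context {d1 d2} {X : measurableType d1} {Y : measurableType d2} {R : realType}.
Variables (V lam : X * Y -> R) (N : nat) (z : 'I_N -> X * Y).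

Definition total_weight (xy : X * Y) : R := lam xy + \sum_(l < N) lam (z l).

(* The point mass at [+oo] is the unknown score of [xy].  If all weights vanish,
   division by zero yields the null measure; this happens at the test point
   only on a null event. *)
Definition score_law (xy : X * Y) (A : set (\bar R)) : \bar R :=
  (\sum_(k < N) (lam (z k) / total_weight xy)%:E * \d_((V (z k))%:E) A
   + (lam xy / total_weight xy)%:E * \d_(+oo) A)%E.

(* The measure lives on [R] with [+oo] adjoined, so the half-line ]-oo, v]
   contains real points only: it is the image of a real interval, and does not
   contain the point [-oo] of [\bar R].  [ereal_inf set0 = +oo]. *)
Definition quantile (beta : R) (mu : set (\bar R) -> \bar R) : \bar R :=
  ereal_inf (EFin @` [set v : R | (beta%:E <= mu (EFin @` `]-oo, v]))%E]).

Definition prediction_set (alpha : R) (x : X) : set Y :=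
  [set y | ((V (x, y))%:E <= quantile (1 - alpha) (score_law (x, y)))%E].

End weighted_conformal.

Definition tau {R : realType} (N : nat) (delta : R) (sigma m : 'I_N -> R) : R :=
  N%:R^-1 *
  Num.sqrt (8 * ln (6 / delta) * \sum_(k < N) (4 * sigma k ^+ 2 + m k ^+ 2)).

(* Main.v *)
(* No uniform control of the weighted empirical process is needed. Write a
   = 1 - alpha, m = E lam_(N+1) / N and T(v) for the sum over the
   calibration points of lam_k (1{V_k <= v} - a). The test point is
   miscovered iff T(v) >= a lam_(N+1) for some v < V_(N+1) (and the total
   weight is positive), and T is nondecreasing, so T(v0) < 0 at one fixed
   v0 already forces V_(N+1) > v0 on miscoverage, and T(v0) >= N sqrt m
   forces V_(N+1) <= v0 or lam_(N+1) > N sqrt m on coverage; the latter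
   event has probability at most sqrt m by Markov. Absence of ties makes
   V_(N+1) atomless, hence v0 can be any exact quantile g of V_(N+1), and
   E T(v0) = N (g - a) by change of measure. At a fixed v0 the deviations
   of T have tail exp(-s^2 / (4 A)), A = sum (4 sigma_k^2 + m_k^2): the
   part lam_k 1{...} is controlled by e^(-y) <= 1 - y + y^2/2 and the part
   lam_k - m_k by sub-Gaussianity. This beats the exp(-s^2 / (8 A)) built
   into tau, and N^2 m = sum E lam_k^2 <= A, so there is room for the loss
   of 2 sqrt m in the lower bound. *)

Require Import Defs.
From HB Require Import structures.
From mathcomp Require Import all_boot all_order all_algebra.
From mathcomp Require Import all_classical all_reals all_analysis.
From mathcomp Require Import measurable_realfun.
From mathcomp Require Import ring lra.

Set Implicit Arguments.
Unset Strict Implicit.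
Unset Printing Implicit Defensive.

Import Order.TTheory GRing.Theory Num.Theory.
Import numFieldNormedType.Exports.

Local Open Scope classical_set_scope.
Local Open Scope ring_scope.

(** * Second-order bounds on the exponential *)

Section exponential_bounds.
Variable R : realType.
Implicit Types x y : R.

(** For [x >= 0] the terms of the exponential series are nonnegative, so its partial sums increase
    to the limit; the left side is the third of them. *)
Lemma expR_ge1DxDx2 x : 0 <= x -> 1 + x + x ^+ 2 / 2 <= expR x.
Proof.
move=> x0; rewrite /expR.
have -> : 1 + x + x ^+ 2 / 2 = series (exp_coeff x) 3%N.
  rewrite /series/= !big_nat_recr//= big_geq//= /exp_coeff/=.
  by rewrite expr0 expr1 !divr1 add0r.
apply: nondecreasing_cvgn_le; last exact: is_cvg_series_exp_coeff.
apply/nondecreasing_seqP => n; rewrite /series/= big_nat_recr//= lerDl.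
exact: exp_coeff_ge0.
Qed.

(** The product of [1 - x + x ^+ 2 / 2] and [1 + x + x ^+ 2 / 2] is [1 + x ^+ 4 / 4], at least 1,
    and the second factor is at most [expR x]. *)
Lemma expRN_le x : 0 <= x -> expR (- x) <= 1 - x + x ^+ 2 / 2.
Proof.
move=> x0; rewrite expRN.
have e1 := expR_ge1DxDx2 x0; have e0 := expR_gt0 x.
rewrite -[leLHS]mul1r ler_pdivrMr//.
have : 0 <= (1 - x + x ^+ 2 / 2) by nra.
move=> q0; apply: le_trans (ler_wpM2l q0 e1).
have -> : (1 - x + x ^+ 2 / 2) * (1 + x + x ^+ 2 / 2) = 1 + x ^+ 4 / 4 by field.
by rewrite lerDl divr_ge0// exprn_even_ge0.
Qed.

(** For y = 2 z the right side is 2 plus the square of e^z - e^(-z), and the two bounds above give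
    e^z - e^(-z) >= 2 z when z >= 0. *)
Lemma cosh_ge y : 2 + y ^+ 2 <= expR y + expR (- y).
Proof.
wlog y0 : y / 0 <= y.
  move=> h; have [/h//|/ltW y0] := leP 0 y.
  by have := h (- y); rewrite oppr_ge0 opprK sqrrN [expR (- y) + _]addrC => /(_ y0).
pose z := y / 2.
have z0 : 0 <= z by rewrite divr_ge0.
have yE : y = z + z by rewrite /z; field.
have h1 := expR_ge1DxDx2 z0; have h2 := expRN_le z0.
have h3 : expR z * expR (- z) = 1 by rewrite -expRD subrr expR0.
have h : 2 * z <= expR z - expR (- z) by lra.
rewrite yE opprD !expRD.
have : (2 * z) ^+ 2 <= (expR z - expR (- z)) ^+ 2.
  apply: lerXn2r => //; rewrite nnegrE; first by rewrite mulr_ge0.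
  by apply: le_trans h; rewrite mulr_ge0.
by rewrite sqrrB h3; lra.
Qed.

(** From e^(-1/2) >= 1/2, inverted and squared. This crude value suffices for the variance bound,
    for ln (6 / delta) >= 1 and for the lower tail. *)
Lemma expR1_le4 : expR 1 <= 4 :> R.
Proof.
have h : expR (1 / 2) <= 2 :> R.
  rewrite -[1 / 2]opprK expRN -[leRHS]invrK lef_pV2 ?posrE ?expR_gt0//.
  by apply: le_trans (expR_ge1Dx _); lra.
have -> : 1 = 1 / 2 + 1 / 2 :> R by field.
rewrite expRD; have := expR_gt0 (1 / 2 : R); nra.
Qed.

(* Weighted AM-GM: integrating it is Cauchy-Schwarz for variables with
   [E e^(2u) <= e^k] and [E e^(2v) <= e^l]. *)
Lemma expRD_le_half (u v k l : R) :
  expR (u + v) <=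
  expR ((k + l) / 2) * ((expR (2 * u - k) + expR (2 * v - l)) / 2).
Proof.
have -> : u + v = (k + l) / 2 + ((2 * u - k) / 2 + (2 * v - l) / 2) by field.
rewrite expRD ler_pM2l ?expR_gt0// expRD.
set a := 2 * u - k; set b := 2 * v - l.
have aE : expR a = expR (a / 2) ^+ 2.
  by rewrite expr2 -expRD; congr expR; field.
have bE : expR b = expR (b / 2) ^+ 2.
  by rewrite expr2 -expRD; congr expR; field.
rewrite aE bE; have := sqr_ge0 (expR (a / 2) - expR (b / 2)).
by rewrite sqrrB; lra.
Qed.

End exponential_bounds.

(** * Independence *)

Section independence.
Context {d d'} {W : measurableType d} {T : measurableType d'} {R : realType}.
Variables (P : probability W R) (n : nat) (Z : 'I_n -> {RV P >-> T}).

(** A pi-system generating the sigma-algebra of the [Z k] with [k \in J], so that equalities of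
    measures need only be checked on it. *)
Definition cylinders (J : {set 'I_n}) : set (set W) :=
  [set A | exists2 B : 'I_n -> set T, (forall k, measurable (B k)) &
     A = \bigcap_(k in [set` J]) Z k @^-1` B k].

Lemma cylinders_measurable J : cylinders J `<=` measurable.
Proof.
move=> _ [B mB ->]; apply: fin_bigcap_measurable => // k _.
exact: measurable_funPTI.
Qed.

Lemma cylindersT J : cylinders J setT.
Proof.
exists (fun=> setT) => //; apply/seteqP; split => // w _ k _ //.
Qed.

Lemma preimage_cylinders (J : {set 'I_n}) k B : k \in J -> measurable B ->
  cylinders J (Z k @^-1` B).
Proof.
move=> kJ mB; exists (fun i => if i == k then B else setT).
  by move=> i; case: ifP.
apply/seteqP; split => [w Bw i _|w /(_ k kJ)]/=; last by rewrite eqxx.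
by case: eqP => // ->.
Qed.

Lemma sigma_cylinders_measurable J : <<s cylinders J >> `<=` measurable.
Proof.
apply: smallest_sub; first exact: sigma_algebra_measurable.
exact: cylinders_measurable.
Qed.

Hypothesis Z_indep : mutually_independent Z.

(** As functions of [A] both sides are finite measures. They agree on the pi-system [cylinders J] by
    the product rule, hence on the sigma-algebra it generates. *)
Lemma sigma_cylinders_indep (J : {set 'I_n}) A j C : <<s cylinders J >> A -> j \notin J ->
  measurable C -> P (A `&` Z j @^-1` C) = (P A * P (Z j @^-1` C))%E.
Proof.
move=> sA jJ mC.
have mZC : measurable (Z j @^-1` C) by exact: measurable_funPTI.
have PC0 : 0 <= fine (P (Z j @^-1` C)) by exact: fine_ge0.
pose m1 := mrestr P mZC.
pose m2 := mscale (NngNum PC0) P.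
suff : m1 A = m2 A.
  by rewrite /m1 /m2/= /mrestr /mscale/= fineK ?fin_num_measure// muleC.
apply: (g_sigma_algebra_measure_unique (cylinders J) _ (fun=> setT)) => //.
- exact: cylinders_measurable.
- by move=> _; exact: cylindersT.
- by apply/seteqP; split => // w _; exists 0%N.
- move=> _ _ [B mB ->] [B' mB' ->]; exists (fun k => B k `&` B' k).
    by move=> k; exact: measurableI.
  by rewrite -bigcapI.
- move=> _ [B mB ->]; rewrite /m1 /m2/= /mrestr /mscale/=.
  rewrite fineK ?fin_num_measure// Z_indep//.
  (* Adjoining [C] as the component at [j] turns the intersection into a cylinder over [j |: J]. *)
  pose B' k := if k == j then C else B k.
  have mB' k : measurable (B' k) by rewrite /B'; case: ifP.
  have B'J k : k \in J -> B' k = B k.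
    by rewrite /B'; case: eqP => // ->; rewrite (negbTE jJ).
  transitivity (P (\bigcap_(k in [set` j |: J]) Z k @^-1` B' k)).
    congr (P _); apply/seteqP; split => w /=.
      move=> [Bw Cw] k /=; rewrite in_setU1 => /predU1P[->|kJ].
        by rewrite /B' eqxx.
      by rewrite B'J//; exact: Bw.
    move=> Bw; split => [k kJ|]; last first.
      by have := Bw j; rewrite /B' eqxx /= setU11; apply.
    by rewrite -B'J//; apply: Bw; rewrite /= in_setU1 kJ orbT.
  rewrite Z_indep// big_setU1//= {1}/B' eqxx; congr (_ * _)%E.
  by apply: eq_bigr => k kJ; rewrite B'J.
- move=> k; rewrite /m1/= /mrestr setTI.
  by rewrite (le_lt_trans (probability_le1 _ _)) ?ltry.
Qed.

(** Independence makes the joint law of [U] and [Z j] a product measure, and Tonelli's theorem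
    splits the integral. *)
Lemma expectation_indepM (J : {set 'I_n}) (U : W -> R) j (f : T -> R) :
  measurable_fun [set: g_sigma_algebraType (cylinders J)] U ->
  measurable_fun setT f -> (forall w, 0 <= U w) -> (forall x, 0 <= f x) ->
  j \notin J ->
  (\int[P]_w (U w * f (Z j w))%:E =
   \int[P]_w (U w)%:E * \int[P]_w (f (Z j w))%:E)%E.
Proof.
move=> mU mf U0 f0 jJ.
have mU' : measurable_fun setT U.
  by move=> _ B mB; apply: (@sigma_cylinders_measurable J); exact: mU.
pose UM := isMeasurableFun.Build _ _ _ _ _ mU'.
pose U' : {mfun W >-> R} := HB.pack U UM.
have mUZ : measurable_fun setT (fun w => (U w, Z j w)).
  by apply/measurable_fun_pairP.
pose UZM := isMeasurableFun.Build _ _ _ _ _ mUZ.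
pose UZ : {mfun W >-> (R * T)%type} := HB.pack (fun w => (U w, Z j w)) UZM.
pose m1 := distribution P U'; pose m2 := distribution P (Z j).
(* The absolute value makes [h] nonnegative on the whole product space and changes nothing along
   [U]. *)
pose h (z : R * T) := (`|z.1| * f z.2)%:E.
have mh : measurable_fun setT h.
  apply/measurable_EFinP; apply: measurable_funM; last exact: measurableT_comp.
  by apply: measurableT_comp => //; exact: measurable_fst.
have h0 z : (0 <= h z)%E by rewrite lee_fin mulr_ge0.
transitivity (\int[P]_w (h \o UZ) w)%E.
  by apply: eq_integral => w _; rewrite /h/= ger0_norm.
rewrite -ge0_integral_distribution//.
transitivity (\int[m1 \x m2]_z h z)%E.
  apply: eq_measure_integral => A mA _.
  apply/esym; apply: product_measure_unique => //= B C mB mC.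
  rewrite /distribution /pushforward/=.
  have -> : (fun w => (U w, Z j w)) @^-1` (B `*` C) =
            U @^-1` B `&` Z j @^-1` C by [].
  apply: (sigma_cylinders_indep (J := J)) => //.
  by rewrite -[_ @^-1` _]setTI; exact: mU.
rewrite (fubini_tonelli1 _ mh h0).
have mf' : measurable_fun setT (EFin \o f) by exact/measurable_EFinP.
have Ef : (\int[m2]_y (f y)%:E = \int[P]_w (f (Z j w))%:E)%E.
  by rewrite ge0_integral_distribution.
rewrite -Ef; transitivity (\int[m1]_x (`|x|%:E * \int[m2]_y (f y)%:E))%E.
  apply: eq_integral => x _; rewrite -ge0_integralZl_EFin//.
  move=> y _; rewrite lee_fin//.
rewrite ge0_integralZr//=.
- congr (_ * _)%E; rewrite ge0_integral_distribution//.
  by apply: eq_integral => w _; rewrite /= ger0_norm.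
- by apply/measurable_EFinP; exact: normr_measurable.
- by apply/measurable_EFinP; exact: normr_measurable.
- by apply: integral_ge0 => y _; rewrite lee_fin.
Qed.

(** Induction on [s]: the product over the tail is measurable for the cylinders of the tail, which
    do not involve the new index. *)
Lemma expectation_prod_indep (f : 'I_n -> T -> R) (s : seq 'I_n) : uniq s ->
  (forall k, measurable_fun setT (f k)) -> (forall k x, 0 <= f k x) ->
  (\int[P]_w (\prod_(k <- s) f k (Z k w))%:E =
   \prod_(k <- s) \int[P]_w (f k (Z k w))%:E)%E.
Proof.
move=> + mf f0; elim: s => [_|j s IH /= /andP[js us]].
  under eq_integral do rewrite big_nil.
  by rewrite big_nil integral_cst//= mul1e probability_setT.
under eq_integral do rewrite big_cons mulrC.
rewrite big_cons -IH// muleC.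
apply: (@expectation_indepM [set k in s]) => //.
- apply: measurable_prod => k ks.
  apply: measurableT_comp => //.
  move=> _ B mB; rewrite setTI; apply: sub_sigma_algebra.
  by apply: preimage_cylinders; rewrite ?inE.
- by move=> w; exact: prodr_ge0.
- by rewrite inE.
Qed.

End independence.

(** The witness is the infimum of the points where the distribution function [F] reaches [g].
    Right-continuity gives [F >= g] there; the left limit is at most [g], and without an atom it
    equals [F]. *)
Lemma atomless_quantile d (W : measurableType d) (R : realType)
    (P : probability W R) (X : {RV P >-> R}) (g : R) :
  (forall v, P (X @^-1` [set v]) = 0%E) -> 0 < g < 1 ->
  exists v, P [set w | X w <= v] = g%:E.
Proof.
move=> atomless /andP[g0 g1].
pose F v := fine (cdf X v).
have FE v : cdf X v = (F v)%:E by rewrite /F fineK// fin_num_measure.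
have FP v : P [set w | X w <= v] = (F v)%:E.
  rewrite -FE; congr (P _); apply/seteqP; split => w /=; by rewrite in_itv.
have Fnd : {homo F : x y / x <= y}.
  by move=> x y xy; rewrite -lee_fin -!FE; exact: cdf_nondecreasing.
pose A := [set v | g <= F v].
have A0 : A !=set0.
  have /fine_cvgP[_ /cvgrPdist_lt] := @cvg_cdfy1 _ _ _ _ X.
  have e0 : 0 < 1 - g by rewrite subr_gt0.
  move=> /(_ _ e0) [M [_ FM]].
  exists (M + 1); rewrite /A/=.
  have := FM (M + 1); rewrite ltrDl ltr01 => /(_ isT)/=.
  by rewrite ltr_norml => /andP[_]; rewrite -/(F _); lra.
have lA : has_lbound A.
  have /fine_cvgP[_ /cvgrPdist_lt] := @cvg_cdfNy0 _ _ _ _ X.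
  move=> /(_ _ g0) [M [_ FM]].
  exists (M - 1) => v; rewrite /A/= => gv; rewrite leNgt; apply/negP => vM.
  have := FM v; rewrite (lt_trans vM) ?ltrBlDr ?ltrDl// => /(_ isT)/=.
  by rewrite ltr_norml -/(F _) => /andP[+ _]; lra.
have iA : has_inf A by [].
exists (inf A); rewrite FP; congr EFin.
apply/eqP; rewrite eq_le; apply/andP; split.
  have mX (v : R) : measurable [set w | X w <= v].
    rewrite (_ : [set w | _] = X @^-1` `]-oo, v]); first exact: measurable_funPTI.
    by apply/seteqP; split => w /=; rewrite in_itv.
  (* Points increasing to [inf A] from below, where [F] is still under [g]. *)
  pose v n := inf A - n.+1%:R^-1.
  have vlt n : v n < inf A by rewrite ltrBlDr ltrDl invr_gt0.
  have Fv n : F (v n) < g.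
    rewrite ltNge; apply/negP => gF.
    by have := ge_inf lA gF; rewrite leNgt vlt.
  have below : (P (\bigcup_n [set w | (X w <= v n)%R]) <= g%:E)%E.
    have h : P [set w | X w <= v n] @[n --> \oo] -->
             P (\bigcup_n [set w | X w <= v n]).
      apply: nondecreasing_cvg_mu => //; first exact: bigcup_measurable.
      move=> n m nm; apply/subsetPset => w /= /le_trans; apply.
      by rewrite lerB// lef_pV2 ?posrE// ler_nat.
    rewrite -(cvg_lim _ h)//; apply: lime_le; first by apply/cvg_ex; eexists; exact: h.
    by apply: nearW => n; rewrite FP lee_fin ltW.
  rewrite -lee_fin -FP; apply: le_trans below.
  rewrite -[leRHS]adde0 -(atomless (inf A)).
  apply: le_trans (measureU2 _ _ _) => //.
    apply: le_measure; rewrite ?inE//.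
      apply: measurableU; first exact: bigcup_measurable.
      exact: measurable_funPTI.
    move=> w /= Xw; have [Xi|Xi] := ltP (X w) (inf A); last first.
      by right; apply/eqP; rewrite eq_le Xw.
    left; have [n Xn] := ltr_add_invr Xi.
    by exists n => //=; rewrite lerBrDr ltW.
  exact: bigcup_measurable.
rewrite leNgt; apply/negP => Fg.
(* If [F] were below [g] at [inf A], it would stay below [g] just to the right, where elements of
   [A] lie. *)
have /fine_cvgP[_ /cvgrPdist_lt] : cdf X @ (inf A)^'+ --> (F (inf A))%:E.
  by rewrite -FE; exact: cdf_right_continuous.
have e0 : 0 < g - F (inf A) by rewrite subr_gt0.
move=> /(_ _ e0) [e /= e1 Fe].
have [a Aa ae] := inf_adherent e1 iA.
have := ge_inf lA Aa; rewrite le_eqVlt => /predU1P[iAa|iAa].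
  by move: Aa; rewrite /A/= -iAa leNgt Fg.
have := Fe a; rewrite /ball/= distrC ger0_norm ?subr_ge0 ?(ltW iAa)//.
rewrite ltrBlDl => /(_ ae iAa); rewrite -/(F a) ltr_norml => /andP[+ _].
by move: Aa; rewrite /A/=; lra.
Qed.

(** * Moments of a nonnegative sub-Gaussian weight *)

Section ge0_expectation.
Context {d} {W : measurableType d} {R : realType} (P : probability W R).
Implicit Types f g : W -> R.
Local Open Scope ereal_scope.

Lemma ge0_expectation_le f g : measurable_fun setT f -> measurable_fun setT g ->
  (forall w, 0 <= f w <= g w)%R ->
  \int[P]_w (f w)%:E <= \int[P]_w (g w)%:E.
Proof.
move=> mf mg fg; apply: ge0_le_integral => //.
- by move=> w _; rewrite lee_fin; case/andP: (fg w).
- exact/measurable_EFinP.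
- exact/measurable_EFinP.
- by move=> w _; rewrite lee_fin; case/andP: (fg w).
Qed.

Lemma ge0_expectationD f g : measurable_fun setT f -> measurable_fun setT g ->
  (forall w, 0 <= f w)%R -> (forall w, 0 <= g w)%R ->
  \int[P]_w (f w + g w)%:E = \int[P]_w (f w)%:E + \int[P]_w (g w)%:E.
Proof.
move=> mf mg f0 g0; under eq_integral do rewrite EFinD.
by rewrite ge0_integralD//; first [exact/measurable_EFinP|move=> w _; rewrite lee_fin].
Qed.

Lemma ge0_expectationZl (c : R) f : measurable_fun setT f ->
  (forall w, 0 <= f w)%R -> (0 <= c)%R ->
  \int[P]_w (c * f w)%:E = c%:E * \int[P]_w (f w)%:E.
Proof.
move=> mf f0 c0; under eq_integral do rewrite EFinM.
by rewrite ge0_integralZl_EFin//;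
  first [exact/measurable_EFinP|move=> w _; rewrite lee_fin].
Qed.

Lemma expectation_const (c : R) : \int[P]_w c%:E = c%:E.
Proof. by rewrite integral_cst//= probability_setT mule1. Qed.

End ge0_expectation.

Section weight_moments.
Context {d} {W : measurableType d} {R : realType} (P : probability W R).
Variables (U : {RV P >-> R}) (m s : R).
Hypothesis U0 : forall w, 0 <= U w.
Hypothesis EU : (\int[P]_w (U w)%:E = m%:E)%E.
Hypothesis Usg : sub_gaussian P (fun w => U w - m) s.

Let sg t : (\int[P]_w (expR (t * (U w - m)))%:E <= (expR (t ^+ 2 * s ^+ 2 / 2))%:E)%E.
Proof. by have := Usg t; rewrite unlock. Qed.

Let m0 : 0 <= m.
Proof.
by rewrite -lee_fin -EU; apply: integral_ge0 => w _; rewrite lee_fin.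
Qed.

Let mU : measurable_fun setT U. Proof. exact: measurable_funPT. Qed.

Let mUm : measurable_fun setT (fun w => U w - m).
Proof. by apply: measurable_funB. Qed.

(** Integrating [cosh_ge] and using sub-Gaussianity at [t] and [- t] gives 2 + t^2 Var <= 2 e^(t^2
    s^2 / 2), from which a good [t] extracts the variance. *)
Let variance_le : (\int[P]_w ((U w - m) ^+ 2)%:E <= (3 * s ^+ 2)%:E)%E.
Proof.
(* For [s != 0] the choice t^2 = 2 / s^2 makes the exponent 1, and 2 (e - 1) <= 6. For [s = 0] both
   sides vanish at any [t]. *)
have [t t0 ht] : exists2 t, 0 < t &
    2 * (expR (t ^+ 2 * s ^+ 2 / 2) - 1) <= 3 * s ^+ 2 * t ^+ 2.
  have [->|s0] := eqVneq s 0.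
    by exists 1 => //; rewrite expr0n/= mulr0 mul0r expR0 subrr !mulr0 mul0r.
  exists (Num.sqrt 2 / `|s|).
    by rewrite divr_gt0 ?normr_gt0// sqrtr_gt0.
  rewrite expr_div_n sqr_sqrtr// real_normK ?num_real//.
  have -> : 2 / s ^+ 2 * s ^+ 2 / 2 = 1 by field.
  have -> : 3 * s ^+ 2 * (2 / s ^+ 2) = 6 by field.
  by have := expR1_le4 R; lra.
have mW2 : measurable_fun setT (fun w => (U w - m) ^+ 2) by exact: measurable_funX.
have me c : measurable_fun setT (fun w => expR (c * (U w - m))).
  by apply: measurableT_comp => //; exact: measurable_funM.
have : (2%:E + (t ^+ 2)%:E * \int[P]_w ((U w - m) ^+ 2)%:E <=
        (2 * expR (t ^+ 2 * s ^+ 2 / 2))%:E)%E.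
  rewrite -ge0_expectationZl ?exprn_ge0 ?(ltW t0)//; last by move=> w; exact: sqr_ge0.
  rewrite -[2%:E in leLHS](expectation_const P) -ge0_expectationD//; last 2 first.
  - exact: measurable_funM.
  - by move=> w; rewrite mulr_ge0 ?sqr_ge0.
  apply: (@le_trans _ _ (\int[P]_w (expR (t * (U w - m)) + expR ((- t) * (U w - m)))%:E)%E).
    apply: ge0_expectation_le => //.
    - by apply: measurable_funD => //; exact: measurable_funM.
    - exact: measurable_funD.
    - move=> w; rewrite mulNr -exprMn cosh_ge andbT.
      by rewrite addr_ge0// sqr_ge0.
  rewrite ge0_expectationD//; try by move=> w; exact: expR_ge0.
  rewrite mulr_natl mulr2n EFinD; apply: leeD => //.
  by have := sg (- t); rewrite sqrrN.
have : (0 <= \int[P]_w ((U w - m) ^+ 2)%:E)%E.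
  by apply: integral_ge0 => w _; rewrite lee_fin sqr_ge0.
(* An infinite variance, multiplied by the positive [t ^+ 2], would break the finite bound. *)
case: (\int[P]_w _)%E => [x| |]//; last first.
  by rewrite gt0_muley// lte_fin exprn_gt0.
rewrite -EFinM -EFinD !lee_fin => x0 hx.
have t2 : 0 < t ^+ 2 by rewrite exprn_gt0.
by rewrite -(ler_pM2r t2); lra.
Qed.

Lemma weight_second_moment :
  ((m ^+ 2)%:E <= \int[P]_w (U w ^+ 2)%:E <= (m ^+ 2 + 3 * s ^+ 2)%:E)%E.
Proof.
have mW2 : measurable_fun setT (fun w => (U w - m) ^+ 2) by exact: measurable_funX.
have mU2 : measurable_fun setT (fun w => U w ^+ 2) by exact: measurable_funX.
have : (\int[P]_w (U w ^+ 2)%:E + (m ^+ 2)%:E =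
        \int[P]_w ((U w - m) ^+ 2)%:E + (2 * m ^+ 2)%:E)%E.
  rewrite -[in LHS](expectation_const P) -ge0_expectationD//; last 2 first.
  - by move=> w; exact: sqr_ge0.
  - by move=> w; exact: sqr_ge0.
  rewrite expr2 mulrA EFinM -EU -ge0_expectationZl ?mulr_ge0//.
  rewrite -ge0_expectationD//; last 3 first.
  - exact: measurable_funM.
  - by move=> w; exact: sqr_ge0.
  - by move=> w; rewrite !mulr_ge0.
  by apply: eq_integral => w _; congr EFin; ring.
move: variance_le.
have : (0 <= \int[P]_w ((U w - m) ^+ 2)%:E)%E.
  by apply: integral_ge0 => w _; rewrite lee_fin sqr_ge0.
case: (\int[P]_w ((U w - m) ^+ 2)%:E)%E => [x| |]//.
case: (\int[P]_w _)%E => [y| |]//.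
rewrite !lee_fin -!EFinD => x0 xs [] h.
by apply/andP; split; lra.
Qed.

(** Both terms of the exponent depend on the same [U], so they are separated by [expRD_le_half] at
    the price of doubling [t]. The indicator term then needs only the second moment of [U], the
    centred term its sub-Gaussianity. *)
Lemma weight_mgf (C : set W) (q b t : R) : measurable C ->
  (\int[P]_w (U w * \1_C w)%:E = q%:E)%E -> 0 <= b <= 1 -> 0 <= t ->
  (\int[P]_w (expR (t * (q - U w * \1_C w + b * (U w - m))))%:E <=
   (expR (t ^+ 2 * (4 * s ^+ 2 + m ^+ 2)))%:E)%E.
Proof.
move=> mC Eq /andP[b0 b1] t0.
pose X w := U w * \1_C w.
have X0 w : 0 <= X w by rewrite mulr_ge0// indicE.
have XU w : X w <= U w.
  by rewrite /X indicE; case: (_ \in _); rewrite ?mulr1// mulr0.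
have mX : measurable_fun setT X by apply: measurable_funM => //; exact: measurable_indic.
have mX2 : measurable_fun setT (fun w => X w ^+ 2) by exact: measurable_funX.
have mexp c (f : W -> R) : measurable_fun setT f ->
    measurable_fun setT (fun w => expR (c * f w)).
  by move=> mf; apply: measurableT_comp => //; exact: measurable_funM.
have EX : (\int[P]_w (X w)%:E = q%:E)%E by [].
(* Exponents bounding the two terms at [2 * t]. In their half-sum [t ^+ 2 * (4 * s ^+ 2 + m ^+ 2)],
   three of the four [s ^+ 2] come from the second moment and one from sub-Gaussianity. *)
pose k := 2 * t ^+ 2 * (m ^+ 2 + 3 * s ^+ 2).
pose l := 2 * t ^+ 2 * s ^+ 2.
have lower : (\int[P]_w (expR (2 * (t * (q - X w)) - k))%:E <= 1)%E.
  pose c := 2 * t.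
  have c0 : 0 <= c by rewrite mulr_ge0.
  (* Keeping [c * q] on the left makes every integrand nonnegative. *)
  have h : (\int[P]_w (expR (- c * X w))%:E + (c * q)%:E <= (1 + k)%:E)%E.
    rewrite EFinM -EX -ge0_expectationZl// -ge0_expectationD//; last 3 first.
    - exact: mexp.
    - exact: measurable_funM.
    - by move=> w; rewrite mulr_ge0.
    apply: (@le_trans _ _ (\int[P]_w (1 + c ^+ 2 / 2 * U w ^+ 2)%:E)%E).
      apply: ge0_expectation_le.
      - apply: measurable_funD; first exact: mexp.
        exact: measurable_funM.
      - apply: measurable_funD => //; apply: measurable_funM => //.
        exact: measurable_funX.
      - move=> w; rewrite addr_ge0 ?expR_ge0 ?mulr_ge0//=.
        rewrite mulNr; have := expRN_le (mulr_ge0 c0 (X0 w)).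
        have : (c * X w) ^+ 2 <= (c * U w) ^+ 2.
          by rewrite lerXn2r ?nnegrE ?mulr_ge0// ler_wpM2l.
        by rewrite !exprMn; lra.
    have c2 : 0 <= c ^+ 2 / 2 by rewrite divr_ge0// sqr_ge0.
    have mU2 : measurable_fun setT (fun w => U w ^+ 2) by exact: measurable_funX.
    rewrite ge0_expectationD//; last 2 first.
    - exact: measurable_funM.
    - by move=> w; rewrite mulr_ge0// sqr_ge0.
    rewrite expectation_const ge0_expectationZl//; last by move=> w; exact: sqr_ge0.
    rewrite EFinD leeD2l//.
    have -> : k = c ^+ 2 / 2 * (m ^+ 2 + 3 * s ^+ 2) by rewrite /k /c; field.
    rewrite [leRHS]EFinM; apply: lee_wpmul2l; first by rewrite lee_fin.
    by case/andP: weight_second_moment.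
  under eq_integral => w _.
    rewrite (_ : _ - k = (c * q - k) + - c * X w); last by rewrite /c; ring.
    rewrite expRD.
    over.
  rewrite ge0_expectationZl ?expR_ge0//; last exact: mexp.
  have : (0 <= \int[P]_w (expR (- c * X w))%:E)%E.
    by apply: integral_ge0 => w _; rewrite lee_fin expR_ge0.
  move: h; case: (\int[P]_w _)%E => [x| |]//.
  rewrite -EFinD !lee_fin => xk _.
  have -> : 1 = expR (c * q - k) * expR (- (c * q - k)) :> R.
    by rewrite -[RHS]expRD subrr expR0.
  rewrite ler_pM2l ?expR_gt0//.
  (* Here E e^(-c X) <= 1 + k - c q <= e^(k - c q). *)
  by apply: le_trans (expR_ge1Dx _); lra.
have upper : (\int[P]_w (expR (2 * (t * (b * (U w - m))) - l))%:E <= 1)%E.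
  under eq_integral => w _.
    rewrite (_ : _ - l = - l + (2 * t * b) * (U w - m)); last by ring.
    rewrite expRD.
    over.
  rewrite ge0_expectationZl ?expR_ge0//; last exact: mexp.
  apply: (@le_trans _ _ ((expR (- l))%:E * (expR ((2 * t * b) ^+ 2 * s ^+ 2 / 2))%:E)%E).
    by apply: lee_wpmul2l => //; rewrite lee_fin expR_ge0.
  rewrite -EFinM -expRD lee_fin -[leRHS]expR0 ler_expR.
  have b2 : b ^+ 2 <= 1 by rewrite expr_le1.
  have : t ^+ 2 * s ^+ 2 * b ^+ 2 <= t ^+ 2 * s ^+ 2.
    by rewrite ler_piMr// mulr_ge0// sqr_ge0.
  by rewrite /l !exprMn; lra.
have -> : t ^+ 2 * (4 * s ^+ 2 + m ^+ 2) = (k + l) / 2 by rewrite /k /l; field.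
have mu : measurable_fun setT (fun w => expR (2 * (t * (q - X w)) - k)).
  apply: measurableT_comp => //; apply: measurable_funB => //.
  by do 2 apply: measurable_funM => //; exact: measurable_funB.
have mv : measurable_fun setT (fun w => expR (2 * (t * (b * (U w - m))) - l)).
  apply: measurableT_comp => //; apply: measurable_funB => //.
  by do 3 apply: measurable_funM => //.
apply: (@le_trans _ _ (\int[P]_w (expR ((k + l) / 2) / 2 *
    (expR (2 * (t * (q - X w)) - k) + expR (2 * (t * (b * (U w - m))) - l)))%:E)%E).
  apply: ge0_expectation_le.
  - apply: mexp; apply: measurable_funD; first exact: measurable_funB.
    exact: measurable_funM.
  - by apply: measurable_funM => //; exact: measurable_funD.
  - move=> w; rewrite expR_ge0/= mulrDr (le_trans (expRD_le_half _ _ k l))//.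
    by rewrite -/(X w); lra.
rewrite ge0_expectationZl; last 3 first.
- exact: measurable_funD.
- by move=> w; rewrite addr_ge0 ?expR_ge0.
- by rewrite divr_ge0 ?expR_ge0.
rewrite ge0_expectationD//; try by move=> w; exact: expR_ge0.
apply: (@le_trans _ _ ((expR ((k + l) / 2) / 2)%:E * (1 + 1))%E).
  by apply: lee_wpmul2l; [rewrite lee_fin divr_ge0 ?expR_ge0|exact: leeD].
by rewrite -EFinD -EFinM lee_fin; lra.
Qed.

End weight_moments.

(** * Concentration of the weighted sums *)

Section weighted_concentration.
Context {d d'} {W : measurableType d} {T : measurableType d'} {R : realType}.
Variables (P : probability W R) (N : nat) (Z : 'I_N.+1 -> {RV P >-> T}).
Hypothesis hN : (1 <= N)%N.
Hypothesis P_dom : distribution P (Z ord_max) `<< Pcal Z.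
Variable lam : {mfun T >-> R}.
Hypothesis lam_ge0 : forall z, 0 <= lam z.
Hypothesis lam_RN : ae_eq (Pcal Z) [set: T] (EFin \o lam)
  (Radon_Nikodym (charge_of_finite_measure (distribution P (Z ord_max)))
     (Pcal Z)).

Let N0 : 0 < N%:R :> R. Proof. by rewrite ltr0n. Qed.

(** Change of measure: [lam] is the density of the test law with respect to [Pcal], and integrals
    against [Pcal] average those against the calibration laws. *)
Lemma expectation_test_point (h : T -> R) : measurable_fun setT h ->
  (forall z, 0 <= h z) ->
  (N%:R%:E * \int[P]_w (h (Z ord_max w))%:E =
   \sum_(k < N) \int[P]_w (lam (Z (calib k) w) * h (Z (calib k) w))%:E)%E.
Proof.
move=> mh h0.
have mh' : measurable_fun setT (EFin \o h) by exact/measurable_EFinP.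
have mlh : measurable_fun setT (fun z => (lam z * h z)%:E).
  by apply/measurable_EFinP; exact: measurable_funM.
(* The density of the change of variables formula; it and [lam] both agree almost everywhere with
   [Radon_Nikodym]. *)
pose f := Radon_Nikodym_SigmaFinite.f (distribution P (Z ord_max)) (Pcal Z).
have mf : measurable_fun setT f.
  by apply: (measurable_int (Pcal Z)); exact: Radon_Nikodym_SigmaFinite.f_integrable.
have fE : ae_eq (Pcal Z) setT (fun z => (h z)%:E * f z)%E (fun z => (lam z * h z)%:E).
  have h1 : ae_eq (Pcal Z) setT f (EFin \o lam).
    apply: ae_eq_trans (ae_eq_sym lam_RN).
    exact: ae_eq_Radon_Nikodym_SigmaFinite.
  apply: filterS h1 => z /(_ I) /= -> _; by rewrite -EFinM mulrC.
have -> : (\int[P]_w (h (Z ord_max w))%:E = \int[Pcal Z]_z (lam z * h z)%:E)%E.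
  rewrite -(@ge0_integral_distribution _ _ _ _ _ _ (Z ord_max) (EFin \o h))//.
  rewrite -(Radon_Nikodym_SigmaFinite.change_of_variables P_dom)//=.
  apply: ge0_ae_eq_integral => //.
  - exact: emeasurable_funM.
  - move=> z _; apply: mule_ge0; first by rewrite lee_fin.
    exact: Radon_Nikodym_SigmaFinite.f_ge0.
  - by move=> z _; rewrite lee_fin mulr_ge0.
rewrite ge0_integral_mscale//; last by move=> z _; rewrite lee_fin mulr_ge0.
rewrite muleA -EFinM/= divff ?gt_eqF// mul1e.
rewrite ge0_integral_measure_sum//; last by move=> z _; rewrite lee_fin mulr_ge0.
apply: eq_bigr => k _.
have -> : inord k = calib k :> 'I_N.+1.
  by apply: val_inj; rewrite /= inordK// ltnS ltnW.
rewrite (@ge0_integral_distribution _ _ _ _ _ _ (Z (calib k)))//.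
by move=> z; rewrite lee_fin mulr_ge0.
Qed.

Definition mean_weight (k : 'I_N.+1) : R := fine ('E_P[lam \o Z k])%E.

Let mlam k : measurable_fun setT (fun w => lam (Z k w)).
Proof. exact: measurableT_comp. Qed.

(** All these terms together sum to N E h(Z_(N+1)) <= N, so each is finite. This is what makes
    [fine] faithful in the means below. *)
Let sum_weight_fin (h : T -> R) (k : 'I_N) : measurable_fun setT h ->
  (forall z, 0 <= h z <= 1) ->
  (\int[P]_w (lam (Z (calib k) w) * h (Z (calib k) w))%:E)%E \is a fin_num.
Proof.
move=> mh h01; have h0 z : 0 <= h z by case/andP: (h01 z).
have i0 (i : 'I_N) :
    (0 <= \int[P]_w (lam (Z (calib i) w) * h (Z (calib i) w))%:E)%E.
  by apply: integral_ge0 => w _; rewrite lee_fin mulr_ge0.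
rewrite ge0_fin_numE//.
apply: (@le_lt_trans _ _ N%:R%:E); last exact: ltry.
apply: (@le_trans _ _ (N%:R%:E * \int[P]_w (h (Z ord_max w))%:E)%E).
  rewrite expectation_test_point// (bigD1 k)//= leeDl//.
  exact: sume_ge0.
rewrite -[leRHS]mule1 lee_wpmul2l ?lee_fin//.
rewrite -(expectation_const P); apply: ge0_expectation_le => //.
exact: measurableT_comp.
Qed.

Lemma mean_weightE (k : 'I_N) :
  (\int[P]_w (lam (Z (calib k) w))%:E = (mean_weight (calib k))%:E)%E.
Proof.
rewrite /mean_weight unlock fineK//.
have := @sum_weight_fin (fun=> 1) k (measurable_cst _).
under eq_integral do rewrite mulr1.
by apply => z; rewrite ler01 lexx.
Qed.

Lemma sum_mean_weight : \sum_(k < N) mean_weight (calib k) = N%:R.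
Proof.
apply: EFin_inj; rewrite -sumEFin -[RHS]mule1 -(expectation_const P 1).
rewrite (@expectation_test_point (fun=> 1))//.
by apply: eq_bigr => k _; under [RHS]eq_integral do rewrite mulr1; rewrite mean_weightE.
Qed.

Definition mean_weight_on (C : set T) (k : 'I_N.+1) : R :=
  fine (\int[P]_w (lam (Z k w) * \1_C (Z k w))%:E)%E.

Let indic01 (C : set T) z : 0 <= (\1_C z : R) <= 1.
Proof. by rewrite indicE; case: (_ \in _); rewrite ?lexx ?ler01. Qed.

Lemma mean_weight_onE (C : set T) (k : 'I_N) : measurable C ->
  (\int[P]_w (lam (Z (calib k) w) * \1_C (Z (calib k) w))%:E =
   (mean_weight_on C (calib k))%:E)%E.
Proof.
move=> mC; rewrite /mean_weight_on fineK//; apply: sum_weight_fin => //.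
Qed.

Lemma sum_mean_weight_on (C : set T) : measurable C ->
  \sum_(k < N) mean_weight_on C (calib k) =
  N%:R * fine (P (Z ord_max @^-1` C)).
Proof.
move=> mC; apply: EFin_inj; rewrite -sumEFin EFinM fineK; last first.
  by apply: fin_num_measure; exact: measurable_funPTI.
have -> : P (Z ord_max @^-1` C) = (\int[P]_w (\1_C (Z ord_max w))%:E)%E.
  have := integral_indic P measurableT (measurable_funPTI (Z ord_max) mC).
  by rewrite setIT => <-.
rewrite expectation_test_point//.
by apply: eq_bigr => k _; rewrite mean_weight_onE.
Qed.

Variable sigma : 'I_N -> R.
Hypothesis lam_sg : forall k : 'I_N,
  sub_gaussian P (fun w => lam (Z (calib k) w) - mean_weight (calib k)) (sigma k).

Definition variance_proxy : R :=
  \sum_(k < N) (4 * sigma k ^+ 2 + mean_weight (calib k) ^+ 2).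

Let lamZ (k : 'I_N) : {RV P >-> R} := [the {mfun W >-> R} of lam \o Z (calib k)].

(** The change of measure with [lam] itself as integrand turns N E lam_(N+1) into the sum of the E
    lam_k^2, which the moment bounds control. In particular the test weight has finite mean. *)
Let second_moments : exists2 S,
    (N%:R%:E * \int[P]_w (lam (Z ord_max w))%:E = S%:E)%E &
    \sum_(k < N) mean_weight (calib k) ^+ 2 <= S <= variance_proxy.
Proof.
rewrite (@expectation_test_point lam)//.
have h k : ((mean_weight (calib k) ^+ 2)%:E <=
    \int[P]_w (lam (Z (calib k) w) * lam (Z (calib k) w))%:E <=
    (4 * sigma k ^+ 2 + mean_weight (calib k) ^+ 2)%:E)%E.
  have := weight_second_moment (U := lamZ k) (fun w => lam_ge0 _)
    (mean_weightE k) (@lam_sg k).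
  move=> /andP[h1 h2]; apply/andP; split; first exact: h1.
  by apply: le_trans h2 _; rewrite lee_fin; have := sqr_ge0 (sigma k); lra.
exists (\sum_(k < N) fine (\int[P]_w (lam (Z (calib k) w) * lam (Z (calib k) w))%:E)%E).
  rewrite -sumEFin; apply: eq_bigr => k _; rewrite fineK//.
  have /andP[h1 h2] := h k; apply/fin_numPlt/andP; split.
    by apply: lt_le_trans h1; rewrite ltNyr.
  by apply: le_lt_trans h2 _; rewrite ltry.
have hf k : mean_weight (calib k) ^+ 2 <=
    fine (\int[P]_w (lam (Z (calib k) w) * lam (Z (calib k) w))%:E)%E <=
    4 * sigma k ^+ 2 + mean_weight (calib k) ^+ 2.
  by move: (h k); case: (\int[P]_w _)%E => [x| |] /andP[];
    rewrite ?lee_fin ?leye_eq ?leeNy_eq// => -> ->.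
by apply/andP; split; apply: ler_sum => k _; case/andP: (hf k).
Qed.

Lemma mean_test_weightE :
  (\int[P]_w (lam (Z ord_max w))%:E = (mean_weight ord_max)%:E)%E.
Proof.
rewrite /mean_weight unlock fineK//=.
have [S + _] := second_moments.
have : (0 <= \int[P]_w (lam (Z ord_max w))%:E)%E.
  by apply: integral_ge0 => w _; rewrite lee_fin.
by case: (\int[P]_w _)%E => //; rewrite gt0_muley// lte_fin.
Qed.

Lemma mean_test_weight_bounds :
  0 < N%:R * mean_weight ord_max <= variance_proxy.
Proof.
have [S] := second_moments; rewrite mean_test_weightE -EFinM => -[->].
move=> /andP[mS ->]; rewrite andbT (lt_le_trans _ mS)// lt_neqAle sumr_ge0 ?andbT.
  (* If the sum of the m_k^2 were zero, all m_k would vanish, although they sum to [N]. *)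
  apply: contraTN N0 => /eqP s0; rewrite -sum_mean_weight big1 ?ltxx// => k _.
  apply/eqP; rewrite -sqrf_eq0; apply/eqP.
  by apply: (psumr_eq0P _ (esym s0)) => // i _; exact: sqr_ge0.
by move=> k _; exact: sqr_ge0.
Qed.

Hypothesis Z_indep : mutually_independent Z.

(** Chernoff's bound for a centred sum whose generating function factors by independence. One form
    serves both tails of T: [C] the set where [V u <= v] with [b = 1 - alpha] for downward
    deviations, its complement with [b = alpha] for upward ones. *)
Lemma weighted_tail (C : set T) (b x : R) : measurable C -> 0 <= b <= 1 ->
  0 < x ->
  (P [set w | x <= N%:R * fine (P (Z ord_max @^-1` C))
                   - \sum_(k < N) lam (Z (calib k) w) * \1_C (Z (calib k) w)
                   + b * (\sum_(k < N) lam (Z (calib k) w) - N%:R)]%R <=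
   (expR (- (x ^+ 2 / (4 * variance_proxy))))%:E)%E.
Proof.
move=> mC b01 x0.
have A0 : 0 < variance_proxy.
  by case/andP: mean_test_weight_bounds => + ; exact: lt_le_trans.
(* The minimiser of t^2 A - t x, where A is [variance_proxy]. *)
pose t := x / (2 * variance_proxy).
have t0 : 0 < t by rewrite divr_gt0// mulr_gt0.
pose Y k w := mean_weight_on C k - lam (Z k w) * \1_C (Z k w) +
  b * (lam (Z k w) - mean_weight k).
have mY k : measurable_fun setT (Y k).
  apply: measurable_funD.
    apply: measurable_funB => //; apply: measurable_funM => //.
    by apply: measurableT_comp => //; exact: measurable_indic.
  by apply: measurable_funM => //; exact: measurable_funB.
pose X w := \sum_(k < N) Y (calib k) w.
have mX : measurable_fun setT X by exact: measurable_sum.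
have XE w : N%:R * fine (P (Z ord_max @^-1` C))
     - \sum_(k < N) lam (Z (calib k) w) * \1_C (Z (calib k) w)
     + b * (\sum_(k < N) lam (Z (calib k) w) - N%:R) = X w.
  by rewrite /X big_split sumrB -mulr_sumr sumrB sum_mean_weight sum_mean_weight_on.
under eq_set do rewrite XE.
pose XM := isMeasurableFun.Build _ _ _ _ _ mX.
pose X' : {mfun W >-> R} := HB.pack X XM.
apply: le_trans (chernoff (P := P) X' x t0) _.
have -> : - (x ^+ 2 / (4 * variance_proxy)) = t ^+ 2 * variance_proxy - t * x.
  by rewrite /t; field; rewrite gt_eqF.
rewrite expRD [leRHS]EFinM; apply: lee_wpmul2r; first by rewrite lee_fin expR_ge0.
rewrite /mmt_gen_fun unlock.
pose f (k : 'I_N.+1) z := expR (t * (mean_weight_on C k - lam z * \1_C z +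
  b * (lam z - mean_weight k))).
have mf k : measurable_fun setT (f k).
  apply: measurableT_comp => //; apply: measurable_funM => //.
  apply: measurable_funD; last by apply: measurable_funM => //; exact: measurable_funB.
  by apply: measurable_funB => //; apply: measurable_funM.
have calib_inj : injective (@calib N) by move=> i j [] /val_inj.
have := expectation_prod_indep Z_indep (f := f) (s := [seq calib k | k <- enum 'I_N]).
rewrite map_inj_uniq ?enum_uniq// => /(_ isT mf).
have f0 k z : 0 <= f k z by exact: expR_ge0.
move=> /(_ f0) fE.
rewrite [leLHS](_ : _ = \prod_(k < N) \int[P]_w (f (calib k) (Z (calib k) w))%:E)%E; last first.
  transitivity (\prod_(k <- [seq calib k | k <- enum 'I_N]) \int[P]_w (f k (Z k w))%:E)%E.
    rewrite -fE; apply: eq_integral => w _; congr EFin.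
    rewrite big_map big_enum/= mulrC /X mulr_sumr expR_sum.
    by apply: eq_bigr.
  by rewrite big_map big_enum.
rewrite mulr_sumr expR_sum.
(* Nonnegativity is carried along because multiplying the bounds requires it. *)
pose K (y : \bar R) (z : R) := (0 <= y <= z%:E)%E.
suff /andP[] : K (\prod_(k < N) \int[P]_w (f (calib k) (Z (calib k) w))%:E)%E
  (\prod_(k < N) expR (t ^+ 2 * (4 * sigma k ^+ 2 + mean_weight (calib k) ^+ 2))) by [].
apply: (big_ind2 K) => [|y1 z1 y2 z2 /andP[y10 yz1] /andP[y20 yz2]|k _].
- by rewrite /K lee01 lexx.
- by rewrite /K mule_ge0//= EFinM lee_pmul.
- apply/andP; split; first by apply: integral_ge0 => w _; rewrite lee_fin.
  have mZC : measurable (Z (calib k) @^-1` C) by exact: measurable_funPTI.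
  exact: (weight_mgf (U := lamZ k) (fun w => lam_ge0 _) (mean_weightE k)
    (@lam_sg k) mZC (mean_weight_onE k mC) b01 (ltW t0)).
Qed.

End weighted_concentration.

(** * Conditional probability and miscoverage *)

(** The difference [v - u] is positive on [A] but has integral at most 0 there, so it vanishes
    almost everywhere on [A]. *)
Lemma null_set_of_le_integral d (W : measurableType d) (R : realType)
  (P : probability W R) (A : set W) (u v : W -> R) : measurable A ->
  P.-integrable A (EFin \o u) -> P.-integrable A (EFin \o v) ->
  (forall w, A w -> u w < v w) ->
  (\int[P]_(w in A) (v w)%:E <= \int[P]_(w in A) (u w)%:E)%E -> P A = 0%E.
Proof.
move=> mA iu iv uv vu.
have iuv : P.-integrable A (EFin \o (fun w => v w - u w)).
  rewrite (_ : _ \o _ = fun w => (v w)%:E - (u w)%:E)%E; last first.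
    by apply/funext => w; rewrite -EFinB.
  exact: integrableB.
have muv := measurable_int _ iuv.
have h0 : (\int[P]_(w in A) `|(v w - u w)%:E| = 0)%E.
  apply/eqP; rewrite eq_le integral_ge0// andbT.
  rewrite (eq_integral (fun w => (v w)%:E - (u w)%:E)%E); last first.
    by move=> w /set_mem Aw; rewrite /= ger0_norm ?EFinB// subr_ge0 ltW// uv.
  by rewrite integralB// sube_le0.
have /(ae_eq_integral_abs P mA muv)[Q [mQ PQ AQ]] := h0.
apply: (subset_measure0 mA mQ _ PQ) => w Aw; apply: AQ => /= /(_ Aw) []/eqP.
by rewrite subr_eq0 gt_eqF// uv.
Qed.

Section calibration_sigma_algebra.
Context {d d'} {W : measurableType d} {T : measurableType d'} {R : realType}.
Variables (P : probability W R) (N : nat) (Z : 'I_N.+1 -> {RV P >-> T}).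

Local Notation G := (g_sigma_preimage (fun k : 'I_N => Z (calib k) : W -> T)).

(** Calibration events avoid the last index, which makes them independent of the test point. *)
Lemma calibration_sub_cylinders : G `<=` <<s cylinders Z [set~ ord_max] >>.
Proof.
apply: smallest_sub; first exact: smallest_sigma_algebra.
elim/big_ind : _ => [//|A B AG BG w [/AG|/BG]//|k _ _ [B mB <-]].
apply: sub_sigma_algebra; rewrite setTI; apply: preimage_cylinders => //.
by rewrite !inE -val_eqE/= ltn_eqF.
Qed.

Lemma calibration_measurable_fun (k : 'I_N) d2 (T' : measurableType d2)
    (f : T -> T') : measurable_fun setT f ->
  forall B, measurable B -> G ((fun w => f (Z (calib k) w)) @^-1` B).
Proof.
move=> mf B mB; apply: sub_sigma_algebra.
rewrite (bigD1 k)//=; left; exists (f @^-1` B); last by rewrite setTI.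
by rewrite -[_ @^-1` _]setTI; exact: mf.
Qed.

Hypothesis Z_indep : mutually_independent Z.
Variables (E : set W) (f : W -> R).
Hypothesis mE : measurable E.
Hypothesis f_cond : is_cond_prob P G E f.

Let Gsub A : G A -> measurable A.
Proof. by move=> /calibration_sub_cylinders/sigma_cylinders_measurable. Qed.

Let GI A B : G A -> G B -> G (A `&` B).
Proof.
exact: (@measurableI _ (g_sigma_algebraType
  (\big[setU/set0]_(k < N) preimage_set_system setT (Z (calib k)) measurable))).
Qed.

Let indep A H : G A -> measurable H ->
  P (A `&` Z ord_max @^-1` H) = (P A * P (Z ord_max @^-1` H))%E.
Proof.
move=> /calibration_sub_cylinders GA mH.
by apply: (sigma_cylinders_indep Z_indep GA) => //; rewrite !inE eqxx.
Qed.

(** On the part of [A] where [f] exceeds [h], the integral of [f] is the joint probability with [E],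
    at most [h] times the probability of that part by independence; so the part is null. This avoids
    regular conditional laws. *)
Lemma cond_prob_le (A : set W) (H : set T) (h : R) : G A -> measurable H ->
  A `&` E `<=` Z ord_max @^-1` H -> (P (Z ord_max @^-1` H) <= h%:E)%E ->
  P (A `&` [set w | h < f w]) = 0%E.
Proof.
move=> GA mH AEH Ph; case: f_cond => mf f_int fE.
set A' := _ `&` _.
have GA' : G A'.
  apply: GI => //; rewrite (_ : [set w | _] = f @^-1` `]h, +oo[); first exact: mf.
  by apply/seteqP; split => w /=; rewrite in_itv/= andbT.
have mA' := Gsub GA'.
have mH' : measurable (Z ord_max @^-1` H) by exact: measurable_funPTI.
apply: (null_set_of_le_integral (u := cst h) (v := f)) => //.
- exact: finite_measure_integrable_cst.
- exact: integrableS f_int.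
- by move=> w [].
- rewrite fE// (_ : \int[P]_(w in A') (cst h w)%:E = h%:E * P A')%E; last first.
    exact: (integral_cst P mA' h%:E).
  apply: (@le_trans _ _ (P (A' `&` Z ord_max @^-1` H))).
    apply: le_measure; rewrite ?inE; [exact: measurableI|exact: measurableI|].
    by move=> w [[Aw Bw] Ew]; split => //; exact: AEH.
  by rewrite indep// muleC lee_wpmul2r.
Qed.

(** The same argument on the complement of [E]: it takes a share of at most [h] of any calibration
    event inside [A], leaving [1 - h] for [E]. *)
Lemma cond_prob_ge (A : set W) (H : set T) (h : R) : G A -> measurable H ->
  A `\` E `<=` Z ord_max @^-1` H -> (P (Z ord_max @^-1` H) <= h%:E)%E ->
  P (A `&` [set w | f w < 1 - h]) = 0%E.
Proof.
move=> GA mH AEH Ph; case: f_cond => mf f_int fE.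
set A' := _ `&` _.
have GA' : G A'.
  apply: GI => //; rewrite (_ : [set w | _] = f @^-1` `]-oo, 1 - h[); first exact: mf.
  by apply/seteqP; split => w /=; rewrite in_itv.
have mA' := Gsub GA'.
have mH' : measurable (Z ord_max @^-1` H) by exact: measurable_funPTI.
apply: (null_set_of_le_integral (u := f) (v := cst (1 - h))) => //.
- exact: integrableS f_int.
- exact: finite_measure_integrable_cst.
- by move=> w [].
- rewrite fE// (_ : \int[P]_(w in A') (cst (1 - h) w)%:E = (1 - h)%:E * P A')%E;
    last exact: (integral_cst P mA' (1 - h)%:E).
  have : (P (A' `\` E) <= P A' * h%:E)%E.
    apply: (@le_trans _ _ (P (A' `&` Z ord_max @^-1` H))).
      apply: le_measure; rewrite ?inE; [exact: measurableD|exact: measurableI|].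
      by move=> w [[Aw Bw] Ew]; split => //; exact: AEH.
    by rewrite indep// lee_wpmul2l.
  have : P A' = (P (A' `\` E) + P (A' `&` E))%E by exact: measureDI.
  have [p pE] : exists p, P A' = p%:E.
    by exists (fine (P A')); rewrite fineK// fin_num_measure.
  have [q ->] : exists q, P (A' `\` E) = q%:E.
    by exists (fine (P (A' `\` E))); rewrite fineK// fin_num_measure//; exact: measurableD.
  have [r ->] : exists r, P (A' `&` E) = r%:E.
    by exists (fine (P (A' `&` E))); rewrite fineK// fin_num_measure//; exact: measurableI.
  by rewrite pE -EFinD -!EFinM !lee_fin => -[->] ?; lra.
Qed.

End calibration_sigma_algebra.

(** * The miscoverage event in terms of weighted sums *)

Section miscoverage.
Context {d1 d2} {X : measurableType d1} {Y : measurableType d2} {R : realType}.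
Variables (V lam : X * Y -> R) (N : nat) (z : 'I_N -> X * Y).
Hypothesis lam_ge0 : forall u, 0 <= lam u.

(** The numerator of the distribution function of [score_law]; the mass at [+oo] enters only through
    the total weight. *)
Definition weight_below (v : R) : R :=
  \sum_(k < N) lam (z k) * \1_[set u | V u <= v] (z k).

Lemma weight_below_nondecreasing u v : u <= v -> weight_below u <= weight_below v.
Proof.
move=> uv; apply: ler_sum => k _; rewrite ler_wpM2l// !indicE ler_nat.
case: (boolP (_ \in _)) => // /set_mem/= Vu.
by rewrite mem_set//=; exact: le_trans uv.
Qed.

(* If all weights vanish the score law is null and nothing is miscovered,
   which accounts for the positivity of the total weight. *)
Lemma miscoverageP (alpha : R) (xy : X * Y) : alpha < 1 ->
  ~ prediction_set V lam z alpha xy.1 xy.2 <->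
  exists v, [/\ v < V xy, 0 < total_weight lam z xy &
    (1 - alpha) * total_weight lam z xy <= weight_below v].
Proof.
rewrite -subr_gt0; case: xy => x y a0 /=.
have tot0 : 0 <= total_weight lam z (x, y) by rewrite addr_ge0// sumr_ge0.
have div v : 1 - alpha <= weight_below v / total_weight lam z (x, y) <->
    0 < total_weight lam z (x, y) /\
    (1 - alpha) * total_weight lam z (x, y) <= weight_below v.
  rewrite lt_neqAle tot0 andbT eq_sym.
  have [->|tn0] := eqVneq (total_weight lam z (x, y)) 0.
    by rewrite invr0 mulr0 leNgt a0; split => // -[].
  by rewrite ler_pdivlMr ?lt_neqAle ?tot0 1?eq_sym ?tn0//; split => // -[].
have lawE v : score_law V lam z (x, y) (EFin @` `]-oo, v]) =
    (weight_below v / total_weight lam z (x, y))%:E.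
  rewrite /score_law [X in (_ + X)%E](_ : _ = 0%E) ?adde0; last first.
    by rewrite diracE memNset ?mule0// => -[].
  rewrite /weight_below mulr_suml -sumEFin; apply: eq_bigr => k _.
  rewrite diracE -EFinM mulrAC indicE; congr (_ * (nat_of_bool _)%:R / _)%:E.
  apply/idP/idP => /set_mem/=.
    by move=> [u + [uV]]; rewrite in_itv/= uV => ?; apply/mem_set.
  by move=> Vz; apply/mem_set; exists (V (z k)) => //=; rewrite in_itv.
split.
  (* The quantile is an infimum, so the score exceeds it exactly when it exceeds some admissible
     real. *)
  move=> /negP; rewrite -ltNge => /ereal_inf_lt[_ [v /=] + <-].
  by rewrite lawE lee_fin lte_fin => /div[? ?] ?; exists v.
move=> [v [vV t0 av]]; apply/negP; rewrite -ltNge.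
apply: (@le_lt_trans _ _ v%:E); last by rewrite lte_fin.
by apply: ereal_inf_lbound; exists v => //=; rewrite lawE lee_fin; apply/div.
Qed.

End miscoverage.

Lemma measurable_set_ltr d (W : measurableType d) (R : realType) (f g : W -> R) :
  measurable_fun setT f -> measurable_fun setT g ->
  measurable [set w | f w < g w].
Proof.
move=> mf mg; rewrite -[X in measurable X]setTI.
exact: (measurable_fun_ltr mf mg measurableT (Y := [set true])).
Qed.

Lemma measurable_set_ler d (W : measurableType d) (R : realType) (f g : W -> R) :
  measurable_fun setT f -> measurable_fun setT g ->
  measurable [set w | f w <= g w].
Proof.
move=> mf mg; rewrite -[X in measurable X]setTI.
exact: (measurable_fun_ler mf mg measurableT (Y := [set true])).
Qed.

(** * Numerical form of the tail bounds *)

Section tail_arithmetic.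
Variable R : realType.
Implicit Types A L x y delta : R.

Lemma log_six_div_ge1 delta : 0 < delta < 1 -> 1 <= ln (6 / delta).
Proof.
move=> /andP[d0 d1]; rewrite -[leLHS](expRK 1) ler_ln ?posrE ?expR_gt0 ?divr_gt0//.
rewrite ler_pdivlMr//; apply: le_trans (ler_wpM2r (ltW d0) (expR1_le4 R)) _; lra.
Qed.

Lemma expRN_log_six_div delta : 0 < delta -> expR (- ln (6 / delta)) = delta / 6.
Proof. by move=> d0; rewrite expRN lnK ?posrE ?divr_gt0// invf_div. Qed.

(** Meant for x = N tau and y = N sqrt m. Since (x - 4 y)^2 >= 0, one has (x - 2 y)^2 >= x^2 / 2 - 4
    y^2 >= 4 A (L - 1), so the loss of 2 y costs a factor e <= 4. *)
Lemma lower_tail_arith A L x y : 0 < y -> y ^+ 2 <= A -> 1 <= L -> 0 <= x ->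
  x ^+ 2 = 8 * L * A ->
  2 * y < x /\ expR (- ((x - 2 * y) ^+ 2 / (4 * A))) <= 4 * expR (- L).
Proof.
move=> y0 yA L1 x0 xE.
have A0 : 0 < A by apply: lt_le_trans yA; rewrite exprn_gt0.
split.
  rewrite -(ltr_pXn2r (n := 2)) ?nnegrE ?mulr_ge0 ?(ltW y0)//.
  have y2 : 0 < y ^+ 2 by rewrite exprn_gt0.
  by rewrite exprMn xE; nra.
apply: (@le_trans _ _ (expR (1 - L))).
  rewrite ler_expR lerNl opprB ler_pdivlMr ?mulr_gt0//.
  by have := sqr_ge0 (x - 4 * y); nra.
by rewrite expRD ler_wpM2r ?expR_ge0// expR1_le4.
Qed.

End tail_arithmetic.

(** * Measurability of the miscoverage event *)

Section measurable_weights.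
Context {d d1 d2} {W : measurableType d} {X : measurableType d1}
  {Y : measurableType d2} {R : realType}.
Variables (V lam : {mfun (X * Y)%type >-> R}) (N : nat) (z : 'I_N -> W -> X * Y).
Hypothesis mz : forall k, measurable_fun setT (z k).

Lemma weight_below_measurable v :
  measurable_fun setT (fun w => weight_below V lam (z ^~ w) v).
Proof.
apply: measurable_sum => k; apply: measurable_funM; first exact: measurableT_comp.
apply: measurableT_comp => //; apply: measurable_indic.
rewrite (_ : [set u | _] = V @^-1` `]-oo, v]); first exact: measurable_funPTI.
by apply/seteqP; split => u /=; rewrite in_itv.
Qed.

Lemma calibration_weight_measurable :
  measurable_fun setT (fun w => \sum_(k < N) lam (z k w)).
Proof. by apply: measurable_sum => k; exact: measurableT_comp. Qed.

(** The threshold in [miscoverageP] can be raised to a rational because [weight_below] is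
    nondecreasing, so the event is a countable union. *)
Lemma miscoverage_measurable (alpha : R) (u : W -> X * Y) :
  measurable_fun setT u -> (forall t, 0 <= lam t) -> alpha < 1 ->
  measurable [set w | ~ prediction_set V lam (z ^~ w) alpha (u w).1 (u w).2].
Proof.
move=> mu lam0 a1.
pose tot w := total_weight lam (z ^~ w) (u w).
have mtot : measurable_fun setT tot.
  apply: measurable_funD; first exact: measurableT_comp.
  exact: calibration_weight_measurable.
rewrite (_ : [set w | _] = \bigcup_(q : rat) ([set w | ratr q < V (u w)] `&`
    ([set w | 0 < tot w] `&`
     [set w | (1 - alpha) * tot w <= weight_below V lam (z ^~ w) (ratr q)]))).
  apply: bigcupT_measurable_rat => q; apply: measurableI; last apply: measurableI.
  - by apply: measurable_set_ltr => //; exact: measurableT_comp.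
  - exact: measurable_set_ltr.
  - apply: measurable_set_ler; first exact: measurable_funM.
    exact: weight_below_measurable.
apply/seteqP; split => w /=.
  move=> /(miscoverageP V _ lam0 _ a1)[v [vV tot0 av]].
  have [q] := rat_in_itvoo vV; rewrite in_itv/= => /andP[vq qV].
  exists q => //; split => //; split => //; apply: le_trans av _.
  by apply: weight_below_nondecreasing => //; exact: ltW.
by move=> [q _ [qV [t0 aS]]]; apply/(miscoverageP V _ lam0 _ a1); exists (ratr q).
Qed.

End measurable_weights.

(** * The two one-sided bounds *)

Section conformal.
Context {d d1 d2} {W : measurableType d} {X : measurableType d1}
  {Y : measurableType d2} {R : realType}.
Variables (P : probability W R) (N : nat).
Hypothesis hN : (1 <= N)%N.
Variable Z : 'I_N.+1 -> {RV P >-> (X * Y)%type}.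
Hypothesis Z_indep : mutually_independent Z.
Hypothesis P_dom : distribution P (Z ord_max) `<< Pcal Z.
Variable V : {mfun (X * Y)%type >-> R}.
Hypothesis no_ties : {ae P, forall w,
  uniq ((+oo)%E :: [seq (V (Z k w))%:E | k <- enum 'I_N.+1])}.

(** By absolute continuity an atom of the test score is an atom of some calibration score, and by
    independence the two scores would tie with positive probability. *)
Lemma test_score_atomless v : P ((V \o Z ord_max) @^-1` [set v]) = 0%E.
Proof.
pose D := V @^-1` [set v].
have mD : measurable D by exact: measurable_funPTI.
apply/eqP; apply: contraT => PD0.
have : Pcal Z D != 0%E.
  apply: contra PD0 => /eqP PD; apply/eqP.
  exact: ((null_content_dominatesP _ _).1 P_dom D mD PD).
rewrite PcalE => h.
have [k Pk] : exists k : 'I_N, P (Z (calib k) @^-1` D) != 0%E.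
  apply: contrapT => /forallNP Pk; move/negP: h; apply; apply/eqP.
  rewrite big1 ?mule0// => k _; apply/eqP/negPn/negP; exact: Pk.
have kmax : calib k != ord_max by rewrite -val_eqE/= ltn_eqF.
have : P (Z (calib k) @^-1` D `&` Z ord_max @^-1` D) = 0%E.
  have [Q [mQ PQ sQ]] := no_ties.
  apply: (subset_measure0 _ mQ _ PQ).
    by apply: measurableI; exact: measurable_funPTI.
  move=> w [Dk Dm]; apply: sQ => /= /andP[_ /injectiveP] inj.
  by move/eqP: kmax; apply; apply: inj; rewrite Dk Dm.
rewrite (sigma_cylinders_indep Z_indep (J := [set~ ord_max])) ?inE ?eqxx//.
  by move/eqP; rewrite mule_eq0 (negbTE Pk) (negbTE PD0).
by apply: sub_sigma_algebra; apply: preimage_cylinders; rewrite ?inE.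
Qed.

Variable lam : {mfun (X * Y)%type >-> R}.
Hypothesis lam_ge0 : forall z, 0 <= lam z.
Hypothesis lam_RN : ae_eq (Pcal Z) [set: X * Y] (EFin \o lam)
  (Radon_Nikodym (charge_of_finite_measure (distribution P (Z ord_max)))
     (Pcal Z)).
Variable sigma : 'I_N -> R.
Hypothesis lam_sg : forall k : 'I_N,
  sub_gaussian P (fun w => lam (Z (calib k) w) - mean_weight Z lam (calib k)) (sigma k).
Variable alpha : R.
Hypothesis alpha01 : 0 < alpha < 1.
Variable miscov : W -> R.
Local Notation G := (g_sigma_preimage (fun k : 'I_N => Z (calib k) : W -> X * Y)).
Hypothesis miscov_cond : is_cond_prob P G
  [set w | ~ prediction_set V lam (fun k : 'I_N => Z (calib k) w) alpha
                  (Z ord_max w).1 (Z ord_max w).2] miscov.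
Variable delta : R.
Hypothesis delta01 : 0 < delta < 1.

Let t := tau delta sigma (fun k => mean_weight Z lam (calib k)).
Let m := N%:R^-1 * mean_weight Z lam ord_max.
Let A := variance_proxy Z lam sigma.
Let L := ln (6 / delta).
(** The statistic T(v) is [S v w - (1 - alpha) * Lam w]. *)
Let S v w := weight_below V lam (fun k : 'I_N => Z (calib k) w) v.
Let Lam w := \sum_(k < N) lam (Z (calib k) w).

Let N0 : 0 < N%:R :> R. Proof. by rewrite ltr0n. Qed.

Let delta0 : 0 < delta. Proof. by case/andP: delta01. Qed.

Let L1 : 1 <= L. Proof. exact: log_six_div_ge1. Qed.

Let mA : 0 < N%:R * mean_weight Z lam ord_max <= A.
Proof. exact: mean_test_weight_bounds. Qed.

Let m0 : 0 < m.
Proof.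
by rewrite mulr_gt0 ?invr_gt0// -(pmulr_rgt0 _ N0); case/andP: mA.
Qed.

Let A0 : 0 < A. Proof. by case/andP: mA; exact: lt_le_trans. Qed.

Let t_ge0 : 0 <= t.
Proof. by rewrite mulr_ge0 ?invr_ge0 ?(ltW N0)// sqrtr_ge0. Qed.

Let NtE : (N%:R * t) ^+ 2 = 8 * L * A.
Proof.
rewrite /t /tau mulrA divff ?gt_eqF// mul1r sqr_sqrtr//.
by rewrite mulr_ge0 ?(ltW A0)// mulr_ge0// (le_trans ler01).
Qed.

Lemma miscov_measurable : measurable_fun setT miscov.
Proof.
case: miscov_cond => mf _ _ _ B mB; rewrite setTI.
by move: (mf B mB) => /calibration_sub_cylinders/sigma_cylinders_measurable.
Qed.

Let mE : measurable [set w | ~ prediction_set V lam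
  (fun k : 'I_N => Z (calib k) w) alpha (Z ord_max w).1 (Z ord_max w).2].
Proof.
apply: miscoverage_measurable => //; by case/andP: alpha01.
Qed.

(** The space [W] with the calibration sigma-algebra, on which measurability of a function of the
    calibration points means membership in [G]. *)
Let GT := g_sigma_algebraType
  (\big[setU/set0]_(k < N) preimage_set_system setT
     (Z (calib k) : W -> X * Y) measurable).

Let mZG (k : 'I_N) : measurable_fun [set: GT] (Z (calib k) : GT -> X * Y).
Proof.
move=> _ B mB; rewrite setTI.
exact: (calibration_measurable_fun k (f := id) (@measurable_id _ _ _) mB).
Qed.

Let mSG v : measurable_fun [set: GT] (S v).
Proof. exact: (weight_below_measurable V lam mZG). Qed.

Let mLamG : measurable_fun [set: GT] Lam.
Proof. exact: (calibration_weight_measurable lam mZG). Qed.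

Let mTG v : measurable_fun [set: GT] (fun w => S v w - (1 - alpha) * Lam w).
Proof. by apply: measurable_funB => //; exact: measurable_funM. Qed.

Let G_le (c v : R) : G [set w | c <= S v w - (1 - alpha) * Lam w].
Proof.
exact: (@measurable_set_ler _ GT _ (cst c) _ (measurable_cst _) (mTG v)).
Qed.

Let G_lt (v c : R) : G [set w | S v w - (1 - alpha) * Lam w < c].
Proof.
exact: (@measurable_set_ltr _ GT _ _ (cst c) (mTG v) (measurable_cst _)).
Qed.

Let Gmeas B : G B -> measurable B.
Proof. by move=> /calibration_sub_cylinders/sigma_cylinders_measurable. Qed.

Let mVle v : measurable [set u | V u <= v].
Proof. exact: measurable_set_ler. Qed.

Let tail_event_measurable (C : set (X * Y)) (a b x : R) : measurable C ->
  measurable [set w | x <= a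
    - \sum_(k < N) lam (Z (calib k) w) * \1_C (Z (calib k) w)
    + b * (Lam w - N%:R)].
Proof.
move=> mC; apply: measurable_set_ler => //.
have mLam : measurable_fun setT Lam.
  by apply: calibration_weight_measurable => k; exact: measurable_funPT.
apply: measurable_funD; last by apply: measurable_funM => //; exact: measurable_funB.
apply: measurable_funB => //; apply: measurable_sum => k.
apply: measurable_funM; first exact: measurableT_comp.
by apply: measurableT_comp => //; exact: measurable_indic.
Qed.

Let quantile_test (g : R) : 0 < g < 1 ->
  exists v, P (Z ord_max @^-1` [set u | V u <= v]) = g%:E.
Proof.
move=> g01.
exact: (atomless_quantile (X := [the {mfun W >-> R} of V \o Z ord_max])
  test_score_atomless g01).
Qed.

Let test_weight_markov (c : R) : 0 < c ->
  (P (Z ord_max @^-1` [set u | (c < lam u)%R]) <= (mean_weight Z lam ord_max / c)%:E)%E.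
Proof.
move=> c0.
have := markov (P := P) [the {mfun W >-> R} of lam \o Z ord_max] c0
  (@measurable_id _ _ _) (fun r r0 => r0) (fun x y _ _ xy => xy).
rewrite unlock.
rewrite (_ : (\int[P]_w _)%E = (mean_weight Z lam ord_max)%:E); last first.
  rewrite -(mean_test_weightE hN P_dom lam_ge0 lam_RN lam_sg).
  by apply: eq_integral => w _ /=; rewrite ger0_norm.
rewrite (_ : [set w | _] = [set w | c <= lam (Z ord_max w)]); last first.
  by apply/seteqP; split => w /=; rewrite lee_fin ger0_norm.
rewrite -lee_pdivlMl// muleC -EFinM; apply: le_trans.
apply: le_measure; rewrite ?inE.
- by apply: measurable_funPTI; exact: measurable_set_ltr.
- by apply: measurable_set_ler => //; exact: measurableT_comp.
- by move=> w /= /ltW.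
Qed.

(** A version of a conditional probability is nonnegative only almost surely, by [cond_prob_ge] with
    trivial events and [h = 1]. *)
Lemma miscoverage_ge0 : P [set w | miscov w < 0] = 0%E.
Proof.
have := cond_prob_ge Z_indep mE miscov_cond (A := setT) (H := setT) (h := 1).
rewrite setTI subrr preimage_setT probability_setT; apply => //.
exact: (@measurableT _ GT).
Qed.

(** On [B], coverage confines the test point to [H], of probability at most [g + c], so [miscov] is
    almost surely at least [1 - (g + c)], that is [alpha - t]. Off [B] the tail bound applies. *)
Lemma miscoverage_lower :
  (P [set w | (miscov w < alpha - t)%R] <= (2 / 3 * delta)%:E)%E.
Proof.
have mmiscov := miscov_measurable.
have [/andP[_ NmA] /andP[a0 a1]] := (mA, alpha01).
(* With this choice Markov's bound at level N c costs m / c = c, the same as the margin c required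
   of T / N. *)
pose c := Num.sqrt m.
have c0 : 0 < c by rewrite sqrtr_gt0.
have c2 : c ^+ 2 = m by rewrite sqr_sqrtr// ltW.
have mlt x : measurable [set w | miscov w < x] by exact: measurable_set_ltr.
have Nc : (N%:R * c) ^+ 2 = N%:R * mean_weight Z lam ord_max.
  by rewrite exprMn c2 /m; field; rewrite gt_eqF.
have NcA : (N%:R * c) ^+ 2 <= A by rewrite Nc.
have [xt tail] := lower_tail_arith (mulr_gt0 N0 c0)
  NcA L1 (mulr_ge0 (ltW N0) t_ge0) NtE.
have ct : 2 * c < t by move: xt; rewrite mulrCA ltr_pM2l.
(* Here [alpha - t <= - c < 0], and [miscov] is almost surely nonnegative. *)
have [g1|g1] := leP 1 (1 - alpha + t - c).
  apply: (@le_trans _ _ 0%E); last first.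
    by rewrite lee_fin mulr_ge0 ?(ltW delta0)// divr_ge0.
  rewrite -miscoverage_ge0; apply: le_measure; rewrite ?inE// => w /=; lra.
pose g := 1 - alpha + t - c.
have g01 : 0 < g < 1 by apply/andP; split => //; rewrite /g; lra.
have [v Pv] := quantile_test g01.
(* T(v) has mean N (g - (1 - alpha)) = N (t - c), so falling below N c is a deviation by N (t - 2
   c). *)
pose x := N%:R * t - 2 * (N%:R * c).
have x0 : 0 < x by rewrite subr_gt0.
pose B := [set w | N%:R * c <= S v w - (1 - alpha) * Lam w].
have GB : G B := G_le (N%:R * c) v.
have mB := Gmeas GB.
pose H := [set u | V u <= v] `|` [set u | N%:R * c < lam u].
have mH : measurable H by apply: measurableU => //; exact: measurable_set_ltr.
have PH : (P (Z ord_max @^-1` H) <= (g + c)%:E)%E.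
  rewrite preimage_setU (le_trans (measureU2 _ _ _))//.
  - exact: measurable_funPTI.
  - by apply: measurable_funPTI; exact: measurable_set_ltr.
  rewrite EFinD; apply: leeD; first by rewrite -Pv.
  apply: le_trans (test_weight_markov (mulr_gt0 N0 c0)) _; rewrite lee_fin.
  by rewrite ler_pdivrMr ?mulr_gt0// mulrCA -expr2 c2 /m mulrA divff ?gt_eqF// mul1r.
have BH : B `\` [set w | ~ prediction_set V lam
  (fun k : 'I_N => Z (calib k) w) alpha (Z ord_max w).1 (Z ord_max w).2]
    `<=` Z ord_max @^-1` H.
  move=> w [Bw cov]; rewrite /B/= in Bw; rewrite /H/=.
  have [Vv|vV] := leP (V (Z ord_max w)) v; [by left|right].
  rewrite ltNge; apply/negP => lw; apply: cov.
  apply/(miscoverageP V _ lam_ge0 _ a1); exists v.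
  have Lam0 : 0 <= Lam w by exact: sumr_ge0.
  have lw0 := lam_ge0 (Z ord_max w).
  (* This yields a positive total weight: on [B] the sum [S v w] is at least N c. *)
  have S_le : S v w <= Lam w.
    apply: ler_sum => k _; rewrite indicE; case: (_ \in _); rewrite ?mulr1//.
    by rewrite mulr0.
  have Nc0 := mulr_gt0 N0 c0.
  have totE : total_weight lam (fun k : 'I_N => Z (calib k) w) (Z ord_max w) =
    lam (Z ord_max w) + Lam w by [].
  have aLam : 0 <= (1 - alpha) * Lam w by rewrite mulr_ge0// subr_ge0 ltW.
  have alw : 0 <= alpha * lam (Z ord_max w) by rewrite mulr_ge0// ltW.
  rewrite totE -/(S v w); move: (S v w) (Lam w) Bw S_le aLam alw lw lw0 Nc0.
  by move=> s l *; split => //; lra.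
have null := cond_prob_ge Z_indep mE miscov_cond GB mH BH PH.
have tailB : (P (~` B) <= (2 / 3 * delta)%:E)%E.
  (* Since e^(-L) = delta / 6, the factor 4 gives 2 delta / 3. *)
  apply: (@le_trans _ _ (4 * expR (- L))%:E); last first.
    by rewrite lee_fin expRN_log_six_div//; lra.
  apply: (@le_trans _ _ (expR (- (x ^+ 2 / (4 * A))))%:E); last first.
    by rewrite lee_fin.
  apply: le_trans (weighted_tail hN P_dom lam_ge0 lam_RN lam_sg Z_indep
    (mVle v) (b := 1 - alpha) _ x0); last by apply/andP; split; lra.
  apply: le_measure; rewrite ?inE.
  - by apply: measurableC; exact: mB.
  - exact: tail_event_measurable.
  - move=> w /= /negP; rewrite -ltNge Pv/= => Bw.
    rewrite (_ : \sum_(k < N) lam _ * _ = S v w)// -/(Lam w) /x /g.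
    by move: Bw; lra.
apply: (@le_trans _ _ (P (~` B) + P (B `&` [set w | (miscov w < 1 - (g + c))%R]))%E); last first.
  by rewrite null adde0.
apply: le_trans (measureU2 _ _ _) => //.
- apply: le_measure; rewrite ?inE//.
    apply: measurableU; first by apply: measurableC; exact: mB.
    by apply: measurableI => //; exact: mB.
  move=> w /= mw; have [Bw|Bw] := pselect (B w); [right; split => //=|by left].
  by rewrite /g; lra.
- by apply: measurableC; exact: mB.
- by apply: measurableI => //; exact: mB.
Qed.

(** On [B], where T(v) < 0, monotonicity of T puts a miscovered test score above [v], an event of
    probability [h < alpha + t]. Off [B] the tail bound applies. *)
Lemma miscoverage_upper :
  (P [set w | (alpha + t <= miscov w)%R] <= (delta / 6)%:E)%E.
Proof.
have mmiscov := miscov_measurable.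
have [a0 a1] := andP alpha01.
have t0 : 0 < t.
  rewrite lt_neqAle t_ge0 andbT; apply: contraTN A0 => /eqP t0.
  by move: NtE; rewrite -t0 mulr0 expr0n/=; have := L1; nra.
(* The fraction 3/4 keeps [h] strictly below [alpha + t], while the exponent (9/16) 8 L A / (4 A) =
   9 L / 8 is still at least L. *)
pose h := alpha + 3 / 4 * t.
have mle : measurable [set w | alpha + t <= miscov w] by exact: measurable_set_ler.
have mlt y : measurable [set w | y < miscov w] by exact: measurable_set_ltr.
(* A conditional probability exceeds 1 only on a null set. *)
have [h1|h1] := leP 1 h.
  have := cond_prob_le Z_indep mE miscov_cond (A := setT) (H := setT) (h := 1).
  rewrite !setTI preimage_setT probability_setT => /(_ _ measurableT (fun _ _ => I) _).
  move=> h0; apply: (@le_trans _ _ 0%E); last first.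
    by rewrite lee_fin divr_ge0// (ltW delta0).
  rewrite -h0//; last exact: (@measurableT _ GT).
  apply: le_measure; rewrite ?inE// => w /=; move: h1; rewrite /h; lra.
pose g := 1 - h.
have g01 : 0 < g < 1 by apply/andP; split; rewrite /g ?subr_gt0// /h; lra.
have [v Pv] := quantile_test g01.
(* T(v) has mean - x, so leaving [B] is an upward deviation by x. *)
pose x := N%:R * (3 / 4 * t).
have x0 : 0 < x by rewrite mulr_gt0//; lra.
pose B := [set w | S v w - (1 - alpha) * Lam w < 0].
have GB : G B := G_lt v 0.
have mB := Gmeas GB.
pose H := ~` [set u | V u <= v].
have mH : measurable H by exact: measurableC.
have PH : P (Z ord_max @^-1` H) = h%:E.
  rewrite /H -preimage_setC probability_setC//; last exact: measurable_funPTI.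
  rewrite (_ : P _ = g%:E); last by rewrite -Pv.
  by rewrite -EFinB /g opprB addrC subrK.
have BH : B `&` [set w | ~ prediction_set V lam
  (fun k : 'I_N => Z (calib k) w) alpha (Z ord_max w).1 (Z ord_max w).2]
    `<=` Z ord_max @^-1` H.
  move=> w [Bw /(miscoverageP V _ lam_ge0 _ a1)[u [uV _ aS]]] /= Vv.
  rewrite /B/= in Bw.
  have uv : u <= v by apply: le_trans Vv; exact: ltW.
  have Su : S u w <= S v w by exact: weight_below_nondecreasing.
  have alw : 0 <= (1 - alpha) * lam (Z ord_max w) by rewrite mulr_ge0// subr_ge0 ltW.
  move: aS; rewrite /total_weight -/(Lam w) -/(S u w).
  move: (S u w) (S v w) (Lam w) Bw Su alw => s s' l Bw Su alw.
  by apply/negP; rewrite -ltNge; lra.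
have PH' : (P (Z ord_max @^-1` H) <= h%:E)%E by rewrite PH.
have null := cond_prob_le Z_indep mE miscov_cond GB mH BH PH'.
have tailB : (P (~` B) <= (delta / 6)%:E)%E.
  apply: (@le_trans _ _ (expR (- (x ^+ 2 / (4 * A))))%:E); last first.
    rewrite lee_fin -expRN_log_six_div// ler_expR lerN2 -/L.
    have -> : x ^+ 2 = 9 / 16 * (8 * L * A) by rewrite -NtE /x; field.
    rewrite ler_pdivlMr ?mulr_gt0//.
    have : 0 <= L * A by rewrite mulr_ge0 ?(ltW A0)// (le_trans ler01).
    by lra.
  apply: le_trans (weighted_tail hN P_dom lam_ge0 lam_RN lam_sg Z_indep
    mH (b := alpha) _ x0); last by apply/andP; split; lra.
  apply: le_measure; rewrite ?inE.
  - by apply: measurableC; exact: mB.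
  - exact: tail_event_measurable.
  - move=> w /= /negP; rewrite -leNgt PH/= => Bw.
    rewrite (_ : \sum_(k < N) lam _ * _ = Lam w - S v w); last first.
      rewrite /Lam -sumrB; apply: eq_bigr => k _.
      rewrite /H indicC indicE; case: (_ \in _); last by rewrite mulr0 mulr1 subr0.
      by rewrite mulr0 mulr1 subrr.
    rewrite -/(Lam w); move: (S v w) (Lam w) Bw => s l Bw.
    by rewrite /x /h; lra.
apply: (@le_trans _ _ (P (~` B) + P (B `&` [set w | (h < miscov w)%R]))%E); last first.
  by rewrite null adde0.
apply: le_trans (measureU2 _ _ _) => //.
- apply: le_measure; rewrite ?inE//.
    apply: measurableU; first by apply: measurableC; exact: mB.
    by apply: measurableI => //; exact: mB.
  move=> w /= mw; have [Bw|Bw] := pselect (B w); [right; split => //=|by left].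
  by rewrite /h; lra.
- by apply: measurableC; exact: mB.
- by apply: measurableI => //; exact: mB.
Qed.

End conformal.

(** * The two-sided bound *)

Theorem theorem2p1 (R : realType) (d d1 d2 : measure_display)
  (W : measurableType d) (X : measurableType d1) (Y : measurableType d2)
  (P : probability W R) (N : nat) (hN : (1 <= N)%N)
  (Z : 'I_N.+1 -> {RV P >-> (X * Y)%type})
  (Z_indep : mutually_independent Z)
  (P_dom : distribution P (Z ord_max) `<< Pcal Z)
  (lam : {mfun (X * Y)%type >-> R}) (lam_ge0 : forall z, 0 <= lam z)
  (lam_RN : ae_eq (Pcal Z) [set: X * Y] (EFin \o lam)
     (Radon_Nikodym (charge_of_finite_measure (distribution P (Z ord_max)))
        (Pcal Z)))
  (V : {mfun (X * Y)%type >-> R}) (V_ge0 : forall z, 0 <= V z)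
  (alpha : R) (alpha01 : 0 < alpha < 1)
  (no_ties : {ae P, forall w,
     uniq ((+oo)%E :: [seq (V (Z k w))%:E | k <- enum 'I_N.+1])})
  (sigma : 'I_N -> R) (sigma_ge0 : forall k, 0 <= sigma k)
  (lam_sub_gaussian : forall k : 'I_N,
     sub_gaussian P
       (fun w => lam (Z (calib k) w) - fine 'E_P[lam \o Z (calib k)])
       (sigma k))
  (miscov : W -> R)
  (miscov_cond : is_cond_prob P
     (g_sigma_preimage (fun k : 'I_N => Z (calib k) : W -> X * Y))
     [set w | ~ prediction_set V lam (fun k : 'I_N => Z (calib k) w) alpha
                  (Z ord_max w).1 (Z ord_max w).2]
     miscov)
  (delta : R) (delta01 : 0 < delta < 1) :
  let t := tau delta sigma (fun k => fine 'E_P[lam \o Z (calib k)]) in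
  let m := N%:R^-1 * fine 'E_P[lam \o Z ord_max] in
  ((1 - delta)%:E <=
   P [set w |
      (- ((t + 3 * m) / (1 + m)) < miscov w - alpha)%R /\
      (miscov w - alpha)%:E <
       t%:E + ereal_sup (range (fun v : R =>
                           P [set w' | V (Z ord_max w') = v]))])%E.

Proof.
cbv zeta; set t := tau _ _ _; set m := N%:R^-1 * _.
have lam_sg (k : 'I_N) : sub_gaussian P
    (fun w => lam (Z (calib k) w) - mean_weight Z lam (calib k)) (sigma k).
  exact: lam_sub_gaussian.
have [delta0 delta1] := andP delta01; have [a0 a1] := andP alpha01.
have lower := miscoverage_lower hN Z_indep P_dom no_ties lam_ge0 lam_RN lam_sg
  alpha01 miscov_cond delta01.
have upper := miscoverage_upper hN Z_indep P_dom no_ties lam_ge0 lam_RN lam_sg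
  alpha01 miscov_cond delta01.
have mmiscov := miscov_measurable miscov_cond.
have m0 : 0 < m.
  rewrite mulr_gt0 ?invr_gt0 ?ltr0n//.
  have /andP[+ _] := mean_test_weight_bounds hN P_dom lam_ge0 lam_RN lam_sg.
  by rewrite pmulr_rgt0 ?ltr0n.
pose b := (t + 3 * m) / (1 + m).
have mle x : measurable [set w | miscov w <= x] by exact: measurable_set_ler.
have mlt x : measurable [set w | miscov w < x] by exact: measurable_set_ltr.
have mge x : measurable [set w | x <= miscov w] by exact: measurable_set_ler.
have lower' : (P [set w | (miscov w <= alpha - b)%R] <= (2 / 3 * delta)%:E)%E.
  (* For [t < 3] the bound [b] exceeds [t], so the lower bound with [t] applies. For [t >= 3] it is
     at least 1 and [alpha - b] is negative. *)
  have [t3|t3] := ltP t 3.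
    apply: le_trans lower; apply: le_measure; rewrite ?inE// => w /= mw.
    apply: le_lt_trans mw _; rewrite ltrD2l ltrN2 /b ltr_pdivlMr ?addr_gt0//.
    by rewrite mulrDr mulr1 ltrD2l ltr_pM2r.
  have b1 : 1 <= b by rewrite /b ler_pdivlMr ?addr_gt0//; lra.
  apply: (@le_trans _ _ 0%E); last by rewrite lee_fin mulr_ge0 ?divr_ge0// ltW.
  have null := miscoverage_ge0 Z_indep lam_ge0 alpha01 miscov_cond.
  by rewrite -null; apply: le_measure; rewrite ?inE// => w /=; lra.
set c := (t%:E + _)%E.
(* The supremum is over values of a measure, hence nonnegative. *)
have tc : (t%:E <= c)%E.
  have atom0 : range (fun v : R => P [set w' | V (Z ord_max w') = v])
      (P [set w' | V (Z ord_max w') = 0]) by exists 0.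
  by rewrite leeDl//; apply: le_trans (ereal_sup_ubound atom0); exact: measure_ge0.
pose F := [set w | miscov w <= alpha - b] `|` [set w | alpha + t <= miscov w].
have mF : measurable F by exact: measurableU.
have PF : (P F <= delta%:E)%E.
  apply: le_trans (measureU2 _ _ _) _ => //.
  apply: le_trans (leeD lower' upper) _.
  by rewrite -EFinD lee_fin; lra.
apply: (@le_trans _ _ (P (~` F))).
  by rewrite probability_setC// EFinB leeD2l// leeN2.
apply: le_measure; rewrite ?inE; first exact: measurableC.
  apply: measurableI.
    by apply: measurable_set_ltr => //; exact: measurable_funB.
  rewrite -[X in measurable X]setTI; apply: measurable_lte => //.
  by apply/measurable_EFinP; exact: measurable_funB.
move=> w /not_orP[/negP + /negP]; rewrite -!ltNge => wb wt; split.
  by rewrite -/b; lra.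
by apply: lt_le_trans tc; rewrite lte_fin; lra.
Qed.
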